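(* Let $n\ge 3$ and let $M^n$ be an $n$-dimensional complete, connected, smooth Riemannian manifold without boundary, with metric $\langle\,,\rangle$, and suppose $M^n$ is isometric to a Riemannian product $N\times\mathbb{R}$ for some Riemannian manifold $N$. Let $f:M^n\to\mathbb{R}$ be a non-trivial affine function, and let $\alpha:I\subset\mathbb{R}\to M^n$ be a Frenet curve of proper $n$ with Frenet frame $\{V_1,\dots,V_n\}$ and harmonic curvature functions $\{H_1^*,\dots,H_{n-2}^*\}$. If $\alpha$ is an $f$-eikonal $V_n$-slant helix curve with axis $\nabla f$, then along $\alpha$ $$\langle V_{n-(i+1)},\nabla f\rangle = H_i^*\,\langle V_n,\nabla f\rangle,\qquad i=1,\dots,n-2 .$$
   Context: A smooth curve $\alpha=\alpha(s):I\to M^n$ ($I\subset\mathbb{R}$ an interval), parametrized by arc length, is a Frenet curve of proper $n$ if there are orthonormal frame fields $\{V_1=\alpha',V_2,\dots,V_n\}$ along $\alpha$ (the Frenet frame) and positive functions $k_1(s),\dots,k_{n-1}(s)$ (the curvatures) with $$\nabla_{\alpha'}V_i=-k_{i-1}V_{i-1}+k_iV_{i+1},\qquad i=1,\dots,n,$$ where $V_0=V_{n+1}=0$ and $\nabla_{\alpha'}$ is the Riemannian (Levi-Civita) connection along $\alpha$. Harmonic curvature functions $H_i^*:I\to\mathbb{R}$ of $\alpha$ (in terms of $V_n$): $$H_0^*=0,\qquad H_1^*=\frac{k_{n-1}}{k_{n-2}},\qquad H_i^*=\frac{1}{k_{n-(i+1)}}\left\{k_{n-i}H_{i-2}^*-(H_{i-1}^*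 )'\right\}\quad(2\le i\le n-2),$$ where $'=d/ds$. $\nabla f$ is the gradient of the (differentiable) function $f$: $df(X)=\langle\nabla f,X\rangle$. A Frenet curve $\alpha$ is an $f$-eikonal $V_n$-slant helix curve, with axis $\nabla f$, if $\|\nabla f\|$ is constant along $\alpha$ and the function $\langle\nabla f,V_n\rangle$ is a non-zero constant along $\alpha$. A function $f:M^n\to\mathbb{R}$ is affine if for every geodesic $\gamma$ of $M^n$ (with affine parameter $t$) the function $t\mapsto f(\gamma(t))$ is of the form $at+b$ with $a,b$ real constants; it is non-trivial if it is not constant. *)

(* Defs.v *)
From HB Require Import structures.
From mathcomp Require Import all_boot all_order all_algebra.
From mathcomp Require Import all_classical all_reals all_analysis.
Set Implicit Arguments.
Unset Strict Implicit.
Unset Printing Implicit Defensive.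
Import Order.TTheory GRing.Theory Num.Theory numFieldNormedType.Exports.
Local Open Scope classical_set_scope.
Local Open Scope ring_scope.

(* C^oo on the set U (meant to be open): all iterated directional derivatives
   of F are Frechet differentiable at the points of U. *)
Definition smooth_on (R : realType) (E F : normedModType R)
    (U : set E) (f : E -> F) : Prop :=
  forall (vs : seq E) (x : E), U x ->
    differentiable (foldr (fun v h => 'D_v h) f vs) x.

(* Calculus of one variable relative to a set J of parameters (an interval or
   a relatively open part of one), so that endpoints belonging to J are handled
   by one-sided derivatives. *)
Section CalculusOnInterval.
Context (R : realType) (E : normedModType R).

Definition diff_quot (u : R -> E) (s t : R) : E := (t - s)^-1 *: (u t - u s).

Definition derivable_in (J : set R) (u : R -> E) (s : R) : Prop :=
  cvg (diff_quot u s @ within J (s^')).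

Definition derive_in (J : set R) (u : R -> E) (s : R) : E :=
  lim (diff_quot u s @ within J (s^')).

Definition smooth_in (J : set R) (u : R -> E) : Prop :=
  forall (k : nat) (s : R), J s -> derivable_in J (iter k (derive_in J) u) s.

End CalculusOnInterval.

Definition nondegenerate_interval (R : realType) (J : set R) : Prop :=
  is_interval J /\ exists a b, [/\ J a, J b & a < b].

(* A space with an atlas modelled on E. The chart c is phi c : dom c -> E, with
   inverse psi c : phi c @` dom c -> dom c; the values of phi c and psi c
   elsewhere are irrelevant. The tangent space at p is E itself: a vector
   v : E at p stands for the tangent vector whose components in the preferred
   chart (chart_at p) are v. *)
Record charted_space (R : realType) (E : normedModType R) := ChartedSpace {
  carrier :> topologicalType;
  chart : Type;
  dom : chart -> set carrier;
  phi : chart -> carrier -> E;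
  psi : chart -> E -> carrier;
  chart_at : carrier -> chart }.

Arguments chart {R E} c.
Arguments chart_at {R E} _ _.

Section Manifold.
Context (R : realType) (E : normedModType R) (M : charted_space E).

Definition chart_image (c : chart M) : set E := phi c @` dom c.

Record is_smooth_manifold : Prop := IsSmoothManifold {
  manifold_hausdorff : hausdorff_space M;
  manifold_second_countable : @second_countable M;
  dom_open : forall c : chart M, open (dom c);
  image_open : forall c : chart M, open (chart_image c);
  phiK : forall (c : chart M) (p : M), dom c p -> psi c (phi c p) = p;
  phi_continuous : forall (c : chart M) (p : M), dom c p ->
    {for p, continuous (phi c)};
  psi_continuous : forall (c : chart M) (x : E), chart_image c x ->
    {for x, continuous (psi c)};
  mem_chart_at : forall p : M, dom (chart_at M p) p;
  transition_smooth : forall c d : chart M,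
    smooth_on (phi c @` (dom c `&` dom d)) (phi d \o psi c) }.

(* components in the chart c of the tangent vector v at p *)
Definition tcoord (c : chart M) (p : M) (v : E) : E :=
  'D_v (phi c \o psi (chart_at M p)) (phi (chart_at M p) p).

(* tangent vector at psi c x whose components in the chart c are u *)
Definition tvect (c : chart M) (x : E) (u : E) : E :=
  'D_u (phi (chart_at M (psi c x)) \o psi c) x.

Definition metric_field := M -> E -> E -> R.

Implicit Type g : metric_field.

Definition local_metric g (c : chart M) (x u v : E) : R :=
  g (psi c x) (tvect c x u) (tvect c x v).

Record is_riemannian_metric g : Prop := IsRiemannianMetric {
  metric_sym : forall p u v, g p u v = g p v u;
  metric_linear : forall p a u v w,
    g p (a *: u + v) w = a * g p u w + g p v w;
  metric_pos : forall p u, u != 0 -> 0 < g p u u;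
  metric_smooth : forall (c : chart M) (u v : E),
    @smooth_on R E R^o (chart_image c) (fun x => local_metric g c x u v) }.

Definition is_riemannian_manifold g : Prop :=
  is_smooth_manifold /\ is_riemannian_metric g.

Definition tnorm g (p : M) (v : E) : R := Num.sqrt (g p v v).

Definition differentiable_function (f : M -> R) : Prop :=
  forall (c : chart M) (x : E), chart_image c x ->
    differentiable (f \o psi c : E -> R^o) x.

Definition nontrivial_function (f : M -> R) : Prop :=
  ~ exists b : R, forall p, f p = b.

(* df_p(v) *)
Definition differential (f : M -> R) (p : M) (v : E) : R :=
  'D_v (f \o psi (chart_at M p) : E -> R^o) (phi (chart_at M p) p).

Definition is_gradient g (f : M -> R) (X : M -> E) : Prop :=
  forall (p : M) (v : E), differential f p v = g p (X p) v.

Definition smooth_curve (J : set R) (gam : R -> M) : Prop :=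
  {within J, continuous gam} /\
  forall c : chart M, smooth_in (J `&` gam @^-1` dom c) (phi c \o gam).

Definition velocity (J : set R) (gam : R -> M) (s : R) : E :=
  derive_in J (phi (chart_at M (gam s)) \o gam) s.

(* V s is a tangent vector at gam s *)
Definition smooth_field_along (J : set R) (gam : R -> M) (V : R -> E) : Prop :=
  forall c : chart M,
    smooth_in (J `&` gam @^-1` dom c) (fun s => tcoord c (gam s) (V s)).

End Manifold.

Section SmoothMaps.
Context (R : realType) (E F : normedModType R).
Context (M : charted_space E) (N : charted_space F).

Definition smooth_map (Phi : M -> N) : Prop :=
  continuous Phi /\
  forall (c : chart M) (d : chart N),
    smooth_on (phi c @` (dom c `&` Phi @^-1` dom d)) (phi d \o Phi \o psi c).

Definition tangent_map (Phi : M -> N) (p : M) (v : E) : F :=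
  'D_v (phi (chart_at N (Phi p)) \o Phi \o psi (chart_at M p))
       (phi (chart_at M p) p).

End SmoothMaps.

Definition isometric (R : realType) (E F : normedModType R)
    (M : charted_space E) (N : charted_space F)
    (g : metric_field M) (h : metric_field N) : Prop :=
  exists (Phi : M -> N) (Psi : N -> M),
    [/\ cancel Phi Psi, cancel Psi Phi, smooth_map Phi, smooth_map Psi &
        forall p u v,
          h (Phi p) (tangent_map Phi p u) (tangent_map Phi p v) = g p u v].

Section ProductWithLine.
Context (R : realType) (E : normedModType R) (N : charted_space E).

Definition prod_line : charted_space (E * R^o)%type :=
  @ChartedSpace R (E * R^o)%type (N * R^o)%type (chart N)
    (fun c => [set q | dom c q.1])
    (fun c q => (phi c q.1, q.2))
    (fun c y => (psi c y.1, y.2))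
    (fun q => chart_at N q.1).

Definition prod_line_metric (g : metric_field N) : metric_field prod_line :=
  fun q u v => g q.1 u.1 v.1 + u.2 * v.2.

End ProductWithLine.

Section LeviCivita.
Context (R : realType) (n : nat) (M : charted_space 'rV[R]_n).
Variable g : metric_field M.

Definition basis_vec (i : 'I_n) : 'rV[R]_n := delta_mx 0 i.

(* the matrix (g_ij) in the chart c *)
Definition gram (c : chart M) (x : 'rV[R]_n) : 'M[R]_n :=
  \matrix_(i, j) local_metric g c x (basis_vec i) (basis_vec j).

Definition dgram (c : chart M) (x : 'rV[R]_n) (l i j : 'I_n) : R :=
  'D_(basis_vec l) (fun y => gram c y i j : R^o) x.

(* Gamma^k_ij = 1/2 sum_l g^{kl} (d_i g_jl + d_j g_il - d_l g_ij) *)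
Definition christoffel (c : chart M) (x : 'rV[R]_n) (k i j : 'I_n) : R :=
  2^-1 * \sum_(l < n) invmx (gram c x) k l *
    (dgram c x i j l + dgram c x j i l - dgram c x l i j).

(* W is the Levi-Civita covariant derivative at s of the field V along gam, i.e.
   W^k = (V^k)' + Gamma^k_ij (gam^i)' V^j in every chart around gam s. *)
Definition is_cov_derive (J : set R) (gam : R -> M) (V : R -> 'rV[R]_n)
    (s : R) (W : 'rV[R]_n) : Prop :=
  forall c : chart M, dom c (gam s) ->
    tcoord c (gam s) W =
      derive_in J (fun t => tcoord c (gam t) (V t)) s +
      \row_(k < n) \sum_(i < n) \sum_(j < n)
        christoffel c (phi c (gam s)) k i j *
        derive_in J (phi c \o gam) s 0 i * tcoord c (gam s) (V s) 0 j.

(* a geodesic with affine parameter t in J *)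
Definition is_geodesic (J : set R) (gam : R -> M) : Prop :=
  [/\ nondegenerate_interval J, smooth_curve J gam &
      forall t, J t -> is_cov_derive J gam (velocity J gam) t 0].

(* Geodesic completeness: the exponential map is defined on the whole tangent
   space at every point. *)
Definition is_complete : Prop :=
  forall (p : M) (v : 'rV[R]_n), exists gam : R -> M,
    [/\ is_geodesic setT gam, gam 0 = p & velocity setT gam 0 = v].

Definition is_affine (f : M -> R) : Prop :=
  forall (J : set R) (gam : R -> M), is_geodesic J gam ->
    exists a b : R, forall t, J t -> f (gam t) = a * t + b.

(* The frame V and the curvatures k are indexed from 1, as V_1, ..., V_n and
   k_1, ..., k_(n-1), with V_0 = V_(n+1) = 0 (k_0 and k_n are irrelevant).
   Parametrization by arc length is orthonormality for i = j = 1. *)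
Record is_frenet_curve (I : set R) (alpha : R -> M)
    (V : nat -> R -> 'rV[R]_n) (k : nat -> R -> R) : Prop := IsFrenetCurve {
  frenet_interval : nondegenerate_interval I;
  frenet_smooth : smooth_curve I alpha;
  frenet_fields : forall i, (1 <= i <= n)%N ->
    smooth_field_along I alpha (V i);
  frenet_tangent : forall s, I s -> V 1%N s = velocity I alpha s;
  frenet_ends : forall s, I s -> V 0%N s = 0 /\ V n.+1 s = 0;
  frenet_orthonormal : forall i j s, (1 <= i <= n)%N -> (1 <= j <= n)%N ->
    I s -> g (alpha s) (V i s) (V j s) = (i == j)%:R;
  frenet_curvature_pos : forall i s, (1 <= i <= n.-1)%N -> I s -> 0 < k i s;
  frenet_eq : forall i s, (1 <= i <= n)%N -> I s ->
    is_cov_derive I alpha (V i) s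
      (- k i.-1 s *: V i.-1 s + k i s *: V i.+1 s) }.

(* X is the gradient of f *)
Definition is_eikonal_slant (I : set R) (alpha : R -> M)
    (V : nat -> R -> 'rV[R]_n) (X : M -> 'rV[R]_n) : Prop :=
  (exists a : R, forall s, I s -> tnorm g (alpha s) (X (alpha s)) = a) /\
  (exists2 b : R, b != 0 &
    forall s, I s -> g (alpha s) (X (alpha s)) (V n s) = b).

End LeviCivita.

Fixpoint harmonic_curvature (R : realType) (n : nat) (I : set R)
    (k : nat -> R -> R) (i : nat) : R -> R :=
  match i with
  | 0 => fun=> 0
  | j.+1 =>
    match j with
    | 0 => fun s => k n.-1 s / k (n - 2)%N s
    | l.+1 => fun s =>
        (k (n - i.+1)%N s)^-1 *
        (k (n - i)%N s * harmonic_curvature n I k l s -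
         @derive_in R R^o I (harmonic_curvature n I k j) s)
    end
  end.

(* Main.v *)
Require Import Defs.
From HB Require Import structures.
From mathcomp Require Import all_boot all_order all_algebra.
From mathcomp Require Import all_classical all_reals all_analysis.
From mathcomp Require Import ring lra zify.
Import Order.TTheory GRing.Theory Num.Theory numFieldNormedType.Exports.
Local Open Scope classical_set_scope.
Local Open Scope ring_scope.

(** The gradient X of an affine function f is parallel along every smooth
    curve, so differentiating <V_j, X> only differentiates V_j, and the Frenet
    equations give

      <V_j, X>' = - k_(j-1) <V_(j-1), X> + k_j <V_(j+1), X>

    ([gradient_component_deriv]). Here <V_n, X> is a non-zero constant b. The
    equation for j = n yields <V_(n-1), X> = 0, the one for j = n-1 yields
    <V_(n-2), X> = H_1 b, and every further equation expresses the next
    component by the two previous ones through the recursion that defines the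
    functions H_i ([harmonic_recursion]). Along the way the
    derivative of H_i exists, because H_i is <V_(n-i-1), X> / b.

    The substance is that X is parallel when f is merely differentiable and
    affine along geodesics. Write F for f in a chart and G for the bilinear
    form given by the Christoffel symbols at a point x0 of the chart. A geodesic
    issuing from x with velocity v reaches at time 1 the point
      y = x + v - G(v, v) / 2 + o(|v|^2),
    uniformly for x near x0 ([geodesic_estimate]), and F(y) = F(x) + dF_x(v)
    because f is affine along it ([affine_on_geodesic]). This identity makes F
    regular by itself: with F bounded near x0 it bounds dF, so F is Lipschitz;
    with F Lipschitz it makes dF continuous at x0; with dF continuous it gives
    a second-order Taylor formula for F with quadratic term dF_x0(G(v, v)) / 2,
    uniform in x. Comparing the Taylor formulas at x0 and at x0 + h gives
      dF_(x0+h)(w) = dF_x0(w) + dF_x0(G(h, w)) + o(|h| |w|)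
    ([hessian_of_geodesics]): the covariant Hessian of f vanishes. A product
    rule for the pairing of dF with a field along a curve
    ([moving_covector_deriv]) turns this into
    d/ds df(V) = df(DV/ds) ([affine_deriv_along]).

    The expansion of geodesics comes from the geodesic equation: a short geodesic
    is first confined to a small ball of the chart ([geodesic_confined]), where
    continuity of the Christoffel symbols makes its acceleration nearly constant. *)

Set Implicit Arguments.
Unset Strict Implicit.

(** * Derivatives relative to a set of parameters *)

(** Multiplying the difference quotient out gives a condition that also makes
    sense at t = s and is easy to combine with estimates. Unlike [derive_in] it
    says that the derivative exists. *)
Definition has_deriv_in (R : realType) (E : normedModType R) (J : set R)
    (u : R -> E) (s : R) (l : E) : Prop :=
  forall e : R, 0 < e ->
    \forall t \near s, J t -> `|u t - u s - (t - s) *: l| <= e * `|t - s|.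

Section OneVariable.
Context (R : realType) (E : normedModType R).
Implicit Types (J : set R) (u : R -> E) (s : R) (l : E).

Lemma has_deriv_inP J u s l :
  has_deriv_in J u s l <-> diff_quot u s @ within J (s^') --> l.
Proof.
have key t e : t != s ->
    (`|l - diff_quot u s t| <= e) = (`|u t - u s - (t - s) *: l| <= e * `|t - s|).
  move=> ts; have ts0 : 0 < `|t - s| by rewrite normr_gt0 subr_eq0.
  rewrite -(ler_pM2r ts0) mulrC -normrZ -normrN -scalerN opprB /diff_quot scalerBr scalerA.
  by rewrite mulfV ?subr_eq0 // scale1r.
split=> [h|/cvgrPdist_le h].
  apply/cvgrPdist_le => e e0; rewrite !near_withinE.
  by apply: filterS (h e e0) => t ht ts Jt; rewrite key//; exact: ht.
move=> e e0; have := h e e0; rewrite !near_withinE => {}h.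
apply: filterS h => t ht Jt; have [->|ts] := eqVneq t s.
  by rewrite !subrr scale0r subrr !normr0 mulr0.
by rewrite -key//; exact: ht.
Qed.

Lemma limit_point_interval J s :
  nondegenerate_interval J -> J s -> limit_point J s.
Proof.
move=> [Jitv [a [b [Ja Jb ab]]]] Js U /nbhs_ballP[e /= e0 eU].
have pick c : J c -> c != s -> exists y, [/\ y != s, J y & U y].
  move=> Jc cs; have cs0 : 0 < `|c - s| by rewrite normr_gt0 subr_eq0.
  pose m := Num.min 1 (e / (2 * `|c - s|)).
  have m0 : 0 < m by rewrite lt_min ltr01 divr_gt0 // mulr_gt0.
  have m1 : m <= 1 by rewrite ge_min lexx.
  have me : m * `|c - s| < e.
    apply: (@le_lt_trans _ _ (e / (2 * `|c - s|) * `|c - s|)).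
      by rewrite ler_pM2r // ge_min lexx orbT.
    have -> : e / (2 * `|c - s|) * `|c - s| = e / 2.
      by field; rewrite gt_eqF.
    lra.
  exists (s + m * (c - s)); split.
  - by rewrite -subr_eq0 addrC addKr mulf_eq0 negb_or subr_eq0 cs (gt_eqF m0).
  - have [sc|sc] := leP s c.
      by apply: (Jitv s c) => //; nra.
    by apply: (Jitv c s) => //; nra.
  - apply: eU; rewrite -ball_normE /= opprD addrA subrr add0r normrN normrM.
    by rewrite gtr0_norm.
have [eas|] := eqVneq a s; last exact: pick.
by apply: (pick b) => //; rewrite gt_eqF // -eas.
Qed.

(** A one-sided derivative is unique only where J accumulates; this is what makes
    [derive_in] meaningful at the endpoints of an interval. *)
Lemma proper_within_dnbhs J s : limit_point J s -> ProperFilter (within J (s^')).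
Proof.
move=> Js; apply: Build_ProperFilter_ex => P; rewrite /within /= /dnbhs /=.
move=> /Js[y [ys Jy /(_ ys Jy)]]; by exists y.
Qed.

Lemma derive_inE J u s l : limit_point J s ->
  has_deriv_in J u s l -> derive_in J u s = l.
Proof.
move=> Js /has_deriv_inP ul; have := proper_within_dnbhs Js => ?.
exact: cvg_lim ul.
Qed.

Lemma derivable_inP J u s :
  derivable_in J u s -> has_deriv_in J u s (derive_in J u s).
Proof. by move=> ?; apply/has_deriv_inP. Qed.

(** The derivative is local, so the parameter set may be replaced by its part
    lying over a chart, and a function by one that agrees with it there. *)
Lemma has_deriv_in_eq J J' u v s l :
  (\forall t \near s, J' t -> J t /\ u t = v t) -> u s = v s ->
  has_deriv_in J u s l -> has_deriv_in J' v s l.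
Proof.
move=> JJ' us h e e0; have he := h e e0.
near=> t => J't.
have [Jt <-] : J t /\ u t = v t by move: J't; near: t.
by rewrite -us; move: Jt; near: t.
Unshelve. all: by end_near. Qed.

Lemma has_deriv_inZ J u s l (a : R) :
  has_deriv_in J u s l -> has_deriv_in J (fun t => a *: u t) s (a *: l).
Proof.
move=> h e e0; have a1 : 0 < `|a| + 1 by rewrite ltr_wpDl.
have ea : 0 < e / (`|a| + 1) by rewrite divr_gt0.
apply: filterS (h _ ea) => t ht /ht le.
rewrite scalerA mulrC -scalerA -!scalerBr normrZ.
rewrite (le_trans (ler_wpM2l (normr_ge0 a) le)) // mulrA ler_wpM2r //.
by rewrite mulrCA ler_piMr ?(ltW e0) // ler_pdivrMr // mul1r lerDl.
Qed.

Lemma has_deriv_in_lip J u s l : has_deriv_in J u s l ->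
  \forall t \near s, J t -> `|u t - u s| <= (`|l| + 1) * `|t - s|.
Proof.
move=> h; have := h 1 ltr01; apply: filterS => t ht /ht.
rewrite -[X in `|X| <= (_ + _) * _](subrK ((t - s) *: l)) => le.
by rewrite (le_trans (ler_normD _ _))// normrZ; lra.
Qed.

Lemma has_deriv_in_near J u s l (P : E -> Prop) : has_deriv_in J u s l ->
  (\forall y \near u s, P y) -> \forall t \near s, J t -> P (u t).
Proof.
move=> h /nbhs_ballP[e /= e0 eP].
have l1 : 0 < `|l| + 1 by rewrite ltr_wpDl.
near=> t => Jt; apply: eP; rewrite -ball_normE /= distrC.
apply: (@le_lt_trans _ _ ((`|l| + 1) * `|t - s|)).
  by move: Jt; near: t; exact: has_deriv_in_lip.
rewrite -ltr_pdivlMl // distrC; near: t.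
have /nbhs_ballP : nbhs s (ball s ((`|l| + 1)^-1 * e)).
  by apply: nbhsx_ballx; rewrite mulr_gt0 ?invr_gt0.
by move=> [r r0 rb]; apply/nbhs_ballP; exists r => // t /rb; rewrite -ball_normE.
Unshelve. all: by end_near. Qed.

Lemma has_deriv_in_is_derive J u s l :
  nbhs s J -> has_deriv_in J u s l -> is_derive s 1 u l.
Proof.
move=> sJ h.
have cl : (fun t : R => t^-1 *: ((u \o shift s) (t *: 1) - u s)) @ 0^' --> l.
  apply/cvgrPdist_le => e e0; rewrite near_withinE.
  have : \forall t \near s, `|u t - u s - (t - s) *: l| <= e * `|t - s|.
    by apply: filterS2 sJ (h e e0) => t Jt; apply.
  rewrite (near_shift 0); apply: filterS => t; rewrite /= subr0 addrK => le t0.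
  have t0' : 0 < `|t| by rewrite normr_gt0.
  rewrite -(ler_pM2r t0') mulrC -normrZ -normrN -scalerN opprB scalerBr scalerA mulfV //.
  by rewrite scale1r [_%:A]mulr1.
by apply: DeriveDef; [apply/cvg_ex; exists l|exact: cvg_lim cl].
Qed.

Lemma is_derive_has_deriv_in J u s l :
  is_derive s 1 u l -> has_deriv_in J u s l.
Proof.
move=> [du <-] e e0.
have /cvgrPdist_le/(_ _ e0) := du; rewrite near_withinE => h.
rewrite (near_shift 0); apply: filterS h => t ht; rewrite /= subr0 addrK => _.
have [->|t0] := eqVneq t 0.
  by rewrite add0r subrr scale0r subrr !normr0 mulr0.
have t0' : 0 < `|t| by rewrite normr_gt0.
have : `|'D_1 u s - t^-1 *: (u (t *: 1 + s) - u s)| <= e.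
  exact: ht.
rewrite -(ler_pM2r t0') mulrC -normrZ -normrN -scalerN opprB scalerBr scalerA mulfV //.
by rewrite scale1r [_%:A]mulr1.
Qed.

End OneVariable.

Lemma differentiable_near (R : realType) (E F : normedModType R) (f : E -> F) x :
  differentiable f x -> forall e, 0 < e ->
  \forall y \near x, `|f y - f x - 'd f x (y - x)| <= e * `|y - x|.
Proof.
move=> df e e0.
have /eqaddoP/(_ e e0) := diff_locally df.
rewrite [in X in _ -> X](near_shift 0); apply: filterS => h /=.
rewrite subr0 addrK; move: (`|h|) => z.
by rewrite /= -![(_ + _ : _ -> _) _]/(_ + _) -![(- _ : _ -> _) _]/(- _) /= opprD addrA.
Qed.

Lemma has_deriv_in_comp (R : realType) (E F : normedModType R) (f : E -> F)
    (J : set R) (u : R -> E) s l :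
  differentiable f (u s) -> has_deriv_in J u s l ->
  has_deriv_in J (f \o u) s ('d f (u s) l).
Proof.
move=> df hu e e0.
have [k k0 dk] := linear_lipschitz (diff_continuous df).
have l1 : 0 < `|l| + 1 by rewrite ltr_wpDl.
pose e1 := e / 2 / (`|l| + 1); pose e2 := e / 2 / k.
have e10 : 0 < e1 by rewrite !divr_gt0.
have e20 : 0 < e2 by rewrite !divr_gt0.
near=> t => Jt.
have h1 : `|f (u t) - f (u s) - 'd f (u s) (u t - u s)| <= e1 * `|u t - u s|.
  by move: Jt; near: t; apply: (@has_deriv_in_near _ _ _ _ _ _
   (fun y => `|f y - f (u s) - 'd f (u s) (y - u s)| <= e1 * `|y - u s|) hu);
   exact: differentiable_near.
have h2 : `|u t - u s| <= (`|l| + 1) * `|t - s|.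
  by move: Jt; near: t; exact: has_deriv_in_lip.
have h3 : `|u t - u s - (t - s) *: l| <= e2 * `|t - s|.
  by move: Jt; near: t; exact: hu.
rewrite /= -[X in `|X|](subrKA ('d f (u s) (u t - u s))) -linearZ -linearB.
have h4 := dk (u t - u s - (t - s) *: l).
rewrite (le_trans (ler_normD _ _))// (splitr e) mulrDl lerD //.
  rewrite (le_trans h1)// (le_trans (ler_wpM2l (ltW e10) h2))//.
  by rewrite mulrA /e1 mulfVK ?gt_eqF.
rewrite (le_trans h4)// (le_trans (ler_wpM2l (ltW k0) h3))//.
by rewrite mulrA mulrC /e2 [k * _]mulrC mulfVK ?gt_eqF // mulrC.
Unshelve. all: by end_near. Qed.

(** * Mean value inequalities *)

Section MeanValue.
Context (R : realType).

Lemma mean_value (u w : R -> R) (T : R) : 0 <= T ->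
  (forall t, 0 <= t <= T -> is_derive t 1 (u : R -> R^o) (w t)) ->
  exists2 c, 0 <= c <= T & u T - u 0 = w c * T.
Proof.
move=> T0 du.
have [||c cT e] := @MVT_segment R u w 0 T T0.
- by move=> t; rewrite in_itv /= => /andP[t0 tT]; apply: du; rewrite !ltW.
- apply: derivable_within_continuous => t; rewrite in_itv /= => /du h.
  exact: (@ex_derive _ _ _ _ _ _ _ h).
by exists c; [move: cT; rewrite in_itv|rewrite e subr0].
Qed.

Lemma ler_pM3 (a x y x' y' : R) : 0 <= a -> 0 <= x -> 0 <= y ->
  x <= x' -> y <= y' -> a * x * y <= a * x' * y'.
Proof. by move=> *; rewrite -!mulrA ler_wpM2l // ler_pM. Qed.

Lemma mx_entry_le_norm m n (A : 'M[R]_(m, n)) i j : `|A i j| <= `|A|.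
Proof.
by rewrite [leRHS]/Num.Def.normr/= mx_normrE; exact: (le_bigmax _ _ (i, j)).
Qed.

Lemma mx_norm_le m n (A : 'M[R]_(m, n)) (e : R) : 0 <= e ->
  (forall i j, `|A i j| <= e) -> `|A| <= e.
Proof.
move=> e0 Ae; rewrite [leLHS]/Num.Def.normr/= mx_normrE.
by apply: bigmax_le => // -[].
Qed.

Lemma is_derive_entry m n (u : R -> 'M[R]_(m, n)) (t : R) l i j :
  is_derive t 1 u l -> is_derive t 1 (fun t => u t i j : R^o) (l i j).
Proof.
move=> [du <-]; apply: DeriveDef; first exact: ((derivable_mxP _ _ _).1 du).
by rewrite derive_mx // mxE.
Qed.

Lemma mean_value_le m n (u w : R -> 'M[R]_(m, n)) (T K : R) : 0 <= T -> 0 <= K ->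
  (forall t, 0 <= t <= T -> is_derive t 1 u (w t)) ->
  (forall t, 0 <= t <= T -> `|w t| <= K) ->
  `|u T - u 0| <= K * T.
Proof.
move=> T0 K0 du wK; apply: mx_norm_le; first exact: mulr_ge0.
move=> i j; rewrite !mxE.
have [|c cT ->] := @mean_value (fun t => u t i j) (fun t => w t i j) T T0.
  by move=> t /du; exact: is_derive_entry.
rewrite normrM [`|T|]ger0_norm // ler_wpM2r //.
by rewrite (le_trans (mx_entry_le_norm _ _ _)) // wK.
Qed.

Context (E : normedModType R).

(** Comparing with a fixed form l, and not only with 0, gives both the Lipschitz
    bound (l = 0) and strict differentiability at x0 (l the differential at
    x0). *)
Lemma diff_mean_value (F : E -> R^o) (x0 : E) (r K : R) (l : E -> R) :
  (forall x, `|x - x0| <= r -> differentiable F x) ->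
  (forall x v, `|x - x0| <= r -> `|('d F x v : R) - l v| <= K * `|v|) ->
  forall a b, `|a - x0| <= r -> `|b - x0| <= r ->
    `|(F a : R) - F b - l (a - b)| <= K * `|a - b|.
Proof.
move=> dF Fl a b ar br; pose c t := b + t *: (a - b).
have cr t : 0 <= t <= 1 -> `|c t - x0| <= r.
  move=> /andP[t0 t1].
  have -> : c t - x0 = t *: (a - x0) + (1 - t) *: (b - x0).
    by rewrite scalerBl scale1r addrCA -scalerBr opprB subrKA addrAC.
  rewrite (le_trans (ler_normD _ _)) // !normrZ.
  rewrite [`|t|]ger0_norm // [`|1 - t|]ger0_norm ?subr_ge0 //.
  have t1' : 0 <= 1 - t by rewrite subr_ge0.
  have := ler_wpM2l t0 ar; have := ler_wpM2l t1' br; lra.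
have [|t t01] := @mean_value (fun t => F (c t)) (fun t => 'd F (c t) (a - b)) 1 ler01.
  move=> t /cr ctr; apply: (@has_deriv_in_is_derive _ _ setT).
    exact: filterT.
  apply: has_deriv_in_comp; first exact: dF.
  move=> e e0; apply: filterE => t' _.
  rewrite /c opprD addrACA subrr add0r -scalerBl subrr normr0.
  by rewrite mulr_ge0 // ltW.
rewrite mulr1 /c scale1r scale0r addr0 [b + _]addrC subrK => ->.
exact/Fl/cr.
Qed.

End MeanValue.

(** * Second derivatives from curved second-order steps *)

Section SecondOrder.
Context (R : realType) (E : normedModType R).

(** A homogeneous function is controlled by its values on one sphere: bounds on
    differentials need only be checked on vectors of a convenient length. *)
Lemma homogeneous_bound (G : E -> R) (t e : R) : 0 < t ->
  (forall c v, G (c *: v) = c * G v) -> (forall v, `|v| = t -> `|G v| <= e * t) ->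
  forall v, `|G v| <= e * `|v|.
Proof.
move=> t0 GZ Gt v; have [->|v0] := eqVneq v 0.
  by rewrite normr0 mulr0 -(scale0r (0 : E)) GZ mul0r normr0.
have nv : 0 < `|v| by rewrite normr_gt0.
pose c := t / `|v|; have c0 : 0 < c by rewrite divr_gt0.
have ct : c * `|v| = t by rewrite mulfVK // gt_eqF.
have nc : `|c *: v| = t by rewrite normrZ gtr0_norm.
by rewrite -(ler_pM2l c0) mulrCA ct -{1}(gtr0_norm c0) -normrM -GZ Gt.
Qed.

(** [F_geod] is the only information on F beyond differentiability: near x0 the
    increment of F along the curved step x + v - B(v, v) / 2 + o(|v|^2) is exactly
    linear in v. For an affine function in a chart the steps are geodesics. *)
Context (F : E -> R^o) (x0 : E) (B : E -> E -> E) (C : R).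
Hypothesis C0 : 0 <= C.
Hypothesis B_le : forall v w, `|B v w| <= C * `|v| * `|w|.
Hypothesis B_polar : forall v w,
  B (v + w) (v + w) = B v v + (B v w) *+ 2 + B w w.
Hypothesis B_scale : forall c v w, B v (c *: w) = c *: B v w.
Hypothesis F_diff : \forall x \near x0, differentiable F x.
Hypothesis F_geod : forall e, 0 < e -> exists2 d, 0 < d &
  forall x v, `|x - x0| <= d -> `|v| <= d ->
    exists y, `|y - (x + v - 2^-1 *: B v v)| <= e * `|v| ^+ 2 /\
              F y = F x + 'd F x v :> R.

Let D x v : R := 'd F x v.

Let DD x v w : D x (v + w) = D x v + D x w.
Proof. by rewrite /D linearD. Qed.

Let DB x v w : D x (v - w) = D x v - D x w.
Proof. by rewrite /D linearB. Qed.

Let DZ x c v : D x (c *: v) = c * D x v.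
Proof. by rewrite /D linearZ. Qed.

Let F_diff_ball : exists2 d, 0 < d &
  forall x, `|x - x0| <= d -> differentiable F x.
Proof.
have /nbhs_ballP[d /= d0 dF] := F_diff.
exists (d / 2); first by rewrite divr_gt0.
move=> x xd; apply: dF; rewrite -ball_normE /= distrC; lra.
Qed.

(** F is bounded near x0 and dF_x(v) = F(y) - F(x) with y near x0, so dF is bounded
    on vectors of a fixed small length. *)
Let D_bounded : exists L d, [/\ 0 < L, 0 < d &
  forall x v, `|x - x0| <= d -> `|D x v| <= L * `|v|].
Proof.
move: C0 => C0'.
have cF : {for x0, continuous F}.
  exact/differentiable_continuous/(nbhs_singleton F_diff).
have /cvgrPdist_le/(_ 1 ltr01)/nbhs_ballP[d1 /= d10 h1] := cF.
have [d2 d20 h2] := F_geod ltr01.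
pose d := Num.min (d1 / 4) (Num.min d2 (C + 1)^-1).
have C1 : 0 < C + 1 by rewrite ltr_wpDl.
have d0 : 0 < d by rewrite !lt_min d20 invr_gt0 C1 divr_gt0.
have dd1 : d <= d1 / 4 by rewrite ge_min lexx.
have dd2 : d <= d2 by rewrite !ge_min lexx orbT.
have dC : (C + 1) * d <= 1.
  by rewrite mulrC -ler_pdivlMr // div1r !ge_min lexx !orbT.
clearbody d; exists (2 / d), d; split => //; first by rewrite divr_gt0.
move=> x v xd; move: v; apply: (homogeneous_bound d0) => // v vd.
rewrite mulfVK ?gt_eqF //.
have [||y [yv Fy]] := h2 x v; [exact: le_trans dd2|by rewrite vd|].
have nB : `|2^-1 *: B v v| <= C * d ^+ 2.
  rewrite normrZ gtr0_norm ?invr_gt0 //.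
  have := B_le v v; rewrite vd; have := normr_ge0 (B v v); lra.
have yx : `|y - x0| <= 3 * d.
  have -> : y - x0 = (y - (x + v - 2^-1 *: B v v)) + (x - x0 + v - 2^-1 *: B v v).
    by rewrite [x - x0 + v]addrAC [x + v - x0 - _]addrAC subrKA.
  rewrite (le_trans (ler_normD _ _)) //.
  have : `|x - x0 + v - 2^-1 *: B v v| <= `|x - x0| + `|v| + `|2^-1 *: B v v|.
    rewrite (le_trans (ler_normB _ _)) // lerD2r; exact: ler_normD.
  move: yv; rewrite vd; nra.
have y1 : `|F x0 - F y : R| <= 1.
  by apply: h1; rewrite -ball_normE /= distrC; lra.
have x1 : `|F x0 - F x : R| <= 1.
  by apply: h1; rewrite -ball_normE /= distrC; lra.
have -> : D x v = (F x0 - F x) - (F x0 - F y) :> R.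
  by rewrite Fy /D; lra.
by rewrite (le_trans (ler_normB _ _)) //; lra.
Qed.

Let geod_close x v y e : `|y - (x + v - 2^-1 *: B v v)| <= e * `|v| ^+ 2 ->
  `|y - (x + v)| <= (C + e) * `|v| ^+ 2.
Proof.
move: C0 => C0' h.
have -> : y - (x + v) = (y - (x + v - 2^-1 *: B v v)) - 2^-1 *: B v v.
  by rewrite [in RHS]opprB [in RHS]addrA [in RHS]addrAC addrK.
rewrite (le_trans (ler_normB _ _)) // normrZ gtr0_norm ?invr_gt0 //.
have := B_le v v; have := normr_ge0 (B v v); move: h; lra.
Qed.

Let F_lipschitz : exists L d, [/\ 0 < L, 0 < d,
  forall x, `|x - x0| <= d -> differentiable F x,
  forall x v, `|x - x0| <= d -> `|D x v| <= L * `|v| &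
  forall a b, `|a - x0| <= d -> `|b - x0| <= d ->
    `|(F a : R) - F b| <= L * `|a - b|].
Proof.
have [L [d1 [L0 d10 DL]]] := D_bounded.
have [d2 d20 dF] := F_diff_ball.
exists L, (Num.min d1 d2); split => //.
- by rewrite lt_min d10.
- by move=> x; rewrite le_min => /andP[_ /dF].
- by move=> x v; rewrite le_min => /andP[xd _]; exact: DL.
move=> a b am bm; rewrite -[X in `|X|]subr0.
apply: (@diff_mean_value _ _ _ x0 (Num.min d1 d2) L (fun=> 0)) => //.
- by move=> x; rewrite le_min => /andP[_ /dF].
- by move=> x v; rewrite subr0 le_min => /andP[xd _]; exact: DL.
Qed.

(** dF_x(v) differs from F(x + v) - F(x) by O(|v|^2), uniformly in x. For |v| = t
    this finite difference varies by O(|x - x0|), so t is fixed first, to make the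
    quadratic error a small multiple of t, and then x is taken close to x0. *)
Let D_cont e : 0 < e -> exists2 d, 0 < d &
  forall x v, `|x - x0| <= d -> `|D x v - D x0 v| <= e * `|v|.
Proof.
move=> e0; have C1 : 0 < C + 1 by rewrite ltr_wpDl.
have [L [dl [L0 dl0 _ _ FL]]] := F_lipschitz.
have [d2 d20 h2] := F_geod ltr01.
(* t is the common length of the vectors; the last bound makes the quadratic
   errors at x and x0 together at most half of e * t. *)
have [t [t0 td2 tdl tC te]] : exists t, [/\ 0 < t, t <= d2, t <= dl / 4,
    (C + 1) * t <= 1 & 4 * L * ((C + 1) * t) <= e].
  exists (Num.min d2 (Num.min (dl / 4) (Num.min (C + 1)^-1 (e / (4 * L * (C + 1)))))).
  split.
  - by rewrite !lt_min d20 invr_gt0 C1 !divr_gt0 // !mulr_gt0.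
  - by rewrite !ge_min lexx.
  - by rewrite !ge_min lexx orbT.
  - by rewrite mulrC -ler_pdivlMr // div1r !ge_min lexx !orbT.
  - by rewrite mulrA mulrC -ler_pdivlMr ?mulr_gt0 // !ge_min lexx !orbT.
have [d [d0 dd2 ddl de]] : exists d, [/\ 0 < d, d <= d2, d <= dl / 4 &
    4 * L * d <= e * t].
  exists (Num.min d2 (Num.min (dl / 4) (e * t / (4 * L)))); split.
  - by rewrite !lt_min d20 !divr_gt0 // mulr_gt0.
  - by rewrite !ge_min lexx.
  - by rewrite !ge_min lexx orbT.
  - by rewrite mulrC -ler_pdivlMr ?mulr_gt0 // !ge_min lexx !orbT.
exists d => // x v xd; move: v.
apply: (@homogeneous_bound _ t e t0).
  by move=> c v; rewrite !DZ -mulrBr.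
move=> v vt.
have est z : `|z - x0| <= d ->
    `|D z v - ((F (z + v) : R) - F z)| <= L * ((C + 1) * t ^+ 2).
  move=> zd; have [||y [yv Fy]] := h2 z v; [exact: le_trans dd2|by rewrite vt|].
  have yz := geod_close yv; rewrite vt in yz.
  have zv : `|z + v - x0| <= d + t.
    by rewrite addrAC (le_trans (ler_normD _ _)) // vt lerD2r.
  have yx : `|y - x0| <= dl.
    rewrite -(subrK (z + v) y) -addrA (le_trans (ler_normD _ _)) //.
    by move: yz zv; nra.
  have -> : D z v - ((F (z + v) : R) - F z) = (F y : R) - F (z + v).
    by rewrite Fy /D; lra.
  rewrite (le_trans (FL _ _ yx _)) ?(le_trans zv) //; first lra.
  by rewrite ler_pM2l.
have x00 : `|x0 - x0| <= d by rewrite subrr normr0 ltW.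
have e1 := est x xd; have e2 := est x0 x00.
have f1 : `|(F (x + v) : R) - F (x0 + v)| <= L * d.
  rewrite (le_trans (FL _ _ _ _)) //.
  - by rewrite addrAC (le_trans (ler_normD _ _)) // vt; lra.
  - by rewrite addrAC subrr add0r vt; lra.
  - by rewrite ler_pM2l // opprD addrACA subrr addr0.
have f2 : `|(F x : R) - F x0| <= L * d.
  rewrite (le_trans (FL _ _ _ _)) //; [lra|lra|by rewrite ler_pM2l].
move: e1 e2 f1 f2; rewrite !ler_norml => /andP[? ?] /andP[? ?] /andP[? ?] /andP[? ?].
have : 4 * L * ((C + 1) * t) * t <= e * t by rewrite ler_pM2r.
lra.
Qed.

Let F_strict e : 0 < e -> exists2 d, 0 < d &
  forall a b, `|a - x0| <= d -> `|b - x0| <= d ->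
    `|(F a : R) - F b - D x0 (a - b)| <= e * `|a - b|.
Proof.
move=> e0; have [d1 d10 h1] := D_cont e0; have [d2 d20 h2] := F_diff_ball.
exists (Num.min d1 d2); first by rewrite lt_min d10.
move=> a b am bm.
apply: (@diff_mean_value _ _ _ x0 (Num.min d1 d2) e (fun v => D x0 v)) => //.
- by move=> x; rewrite le_min => /andP[_ /h2].
- by move=> x v; rewrite le_min => /andP[xd _]; exact: h1.
Qed.

(** F(x + v) - F(y) is evaluated by strict differentiability at x0: the two points
    differ by B(v, v) / 2 up to o(|v|^2). *)
Let F_taylor e : 0 < e -> exists2 d, 0 < d &
  forall x v, `|x - x0| <= d -> `|v| <= d ->
    `|(F (x + v) : R) - F x - D x v - 2^-1 * D x0 (B v v)| <= e * `|v| ^+ 2.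
Proof.
move=> e0; have C1 : 0 < C + 1 by rewrite ltr_wpDl.
have [L [dl [L0 dl0 _ DL _]]] := F_lipschitz.
have [e1 [e10 e11 e1L]] : exists e1, [/\ 0 < e1, e1 <= 1 & L * e1 <= e / 2].
  exists (Num.min 1 (e / 2 / L)); split.
  - by rewrite lt_min ltr01 !divr_gt0.
  - by rewrite ge_min lexx.
  - by rewrite mulrC -ler_pdivlMr // ge_min lexx orbT.
have e20 : 0 < e / 2 / (C + 1) by rewrite !divr_gt0.
have [d1 d10 h1] := F_strict e20.
have [d2 d20 h2] := F_geod e10.
have [d [d0 dd1 dd2 dC]] : exists d, [/\ 0 < d, d <= d1 / 4, d <= d2 &
    (C + 1) * d <= 1].
  exists (Num.min (d1 / 4) (Num.min d2 (C + 1)^-1)); split.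
  - by rewrite !lt_min d20 invr_gt0 C1 divr_gt0.
  - by rewrite ge_min lexx.
  - by rewrite !ge_min lexx orbT.
  - by rewrite mulrC -ler_pdivlMr // div1r !ge_min lexx !orbT.
exists d => // x v xd vd.
have [||y [yv Fy]] := h2 x v; [exact: le_trans dd2|exact: le_trans dd2|].
have yz0 := geod_close yv.
have v2 := sqr_ge0 (`|v|); have v0 := normr_ge0 v.
have yz : `|y - (x + v)| <= (C + 1) * `|v| ^+ 2.
  by rewrite (le_trans yz0) // ler_wpM2r // lerD2l.
have zv : `|x + v - x0| <= d + d.
  by rewrite addrAC (le_trans (ler_normD _ _)) // lerD.
have yx : `|y - x0| <= d1.
  rewrite -(subrK (x + v) y) -addrA (le_trans (ler_normD _ _)) //.
  have : (C + 1) * `|v| ^+ 2 <= `|v|.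
    rewrite expr2 mulrA ler_piMl // (le_trans _ dC) // ler_pM2l //.
  lra.
have zx : `|x + v - x0| <= d1 by lra.
have := h1 _ _ yx zx.
have Dsplit : D x0 (y - (x + v)) =
    D x0 (y - (x + v - 2^-1 *: B v v)) - 2^-1 * D x0 (B v v).
  rewrite -DZ -DB; congr (D x0 _).
  by rewrite [in RHS]opprB [in RHS]addrA [in RHS]addrAC addrK.
have x00 : `|x0 - x0| <= dl by rewrite subrr normr0 ltW.
have := DL x0 (y - (x + v - 2^-1 *: B v v)) x00.
have q1 : L * `|y - (x + v - 2^-1 *: B v v)| <= e / 2 * `|v| ^+ 2.
  rewrite (le_trans (ler_wpM2l (ltW L0) yv)) // mulrA ler_wpM2r //.
have q2 : e / 2 / (C + 1) * `|y - (x + v)| <= e / 2 * `|v| ^+ 2.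
  rewrite (le_trans (ler_wpM2l (ltW e20) yz)) // mulrA mulfVK // gt_eqF //.
move=> /le_trans/(_ q1) + /le_trans/(_ q2).
rewrite Dsplit Fy -/(D x v) !ler_norml => /andP[? ?] /andP[? ?].
by apply/andP; split; lra.
Qed.

(** F(x0 + h + w) is expanded in two ways: from x0 with increment h + w, and from
    x0 + h with increment w. Subtracting, and using the expansion of F(x0 + h), the
    polarization of B leaves the cross term. The errors are quadratic, so the vector
    w is taken of the length of h and the general case follows by homogeneity. *)
Lemma hessian_of_geodesics e : 0 < e -> exists2 d, 0 < d &
  forall h w, `|h| <= d ->
    `|('d F (x0 + h) w : R) - 'd F x0 w - 'd F x0 (B h w)| <= e * `|h| * `|w|.
Proof.
move=> e0; have e60 : 0 < e / 6 by rewrite divr_gt0.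
have [d d0 T] := F_taylor e60.
exists (d / 2); first by rewrite divr_gt0.
move=> h w hd; have [->|h0] := eqVneq h 0.
  rewrite addr0 subrr sub0r normrN normr0 mulr0 mul0r.
  have -> : B 0 w = 0.
    apply/eqP; rewrite -normr_le0 (le_trans (B_le _ _)) //.
    by rewrite normr0 mulr0 mul0r.
  by rewrite linear0 normr0.
have nh : 0 < `|h| by rewrite normr_gt0.
move: w; apply: (@homogeneous_bound (fun w => D (x0 + h) w - D x0 w - D x0 (B h w))
  `|h| _ nh).
  by move=> c w; rewrite B_scale !DZ !mulrBr.
move=> w wh.
have x00 : `|x0 - x0| <= d by rewrite subrr normr0 ltW.
have hx : `|x0 + h - x0| <= d by rewrite addrAC subrr add0r; lra.
have hw : `|h + w| <= 2 * `|h| by rewrite (le_trans (ler_normD _ _)) // wh; lra.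
have := T x0 (h + w) x00; have := T x0 h x00; have := T (x0 + h) w hx.
rewrite wh => /(_ _)/wrap[]; first lra.
move=> t1 /(_ _)/wrap[]; first lra.
move=> t2 /(_ _)/wrap[]; first lra.
rewrite B_polar [B h w *+ 2]mulr2n !DD [x0 + (h + w)]addrA => t3.
have n2 : `|h + w| ^+ 2 <= 4 * `|h| ^+ 2.
  have -> : 4 * `|h| ^+ 2 = (2 * `|h|) ^+ 2 by ring.
  by rewrite lerXn2r // nnegrE // mulr_ge0.
have {}t3 := le_trans t3 (ler_wpM2l (ltW e60) n2).
move: t1 t2 t3; rewrite !ler_norml => /andP[? ?] /andP[? ?] /andP[? ?].
by apply/andP; split; lra.
Qed.

End SecondOrder.

(** * Charts and tangent vectors *)

Section Charts.
Context (R : realType) (E : normedModType R) (M : charted_space E).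
Hypothesis HM : is_smooth_manifold M.
Implicit Types (c d : chart M) (p : M).

Lemma chart_image_phi c p : dom c p -> chart_image c (phi c p).
Proof. by exists p. Qed.

Lemma dom_psi c x : chart_image c x -> dom c (psi c x).
Proof. by move=> [p cp <-]; rewrite (phiK HM). Qed.

Lemma psiK c x : chart_image c x -> phi c (psi c x) = x.
Proof. by move=> [p cp <-]; rewrite (phiK HM). Qed.

Lemma near_dom_psi c (U : set M) p : dom c p -> open U -> U p ->
  \forall x \near phi c p, chart_image c x /\ U (psi c x).
Proof.
move=> cp oU Up; apply: filterI.
  by apply: open_nbhs_nbhs; split; [exact: image_open HM c|exact: chart_image_phi].
apply: (psi_continuous HM (chart_image_phi cp)).
by rewrite (phiK HM) //; apply: open_nbhs_nbhs; split.
Qed.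

Lemma transition_diff c d p : dom c p -> dom d p ->
  differentiable (phi d \o psi c) (phi c p).
Proof. by move=> cp dp; apply: (transition_smooth HM [::]); exists p. Qed.

Lemma tcoordE c p v : dom c p ->
  tcoord c p v = 'd (phi c \o psi (chart_at M p)) (phi (chart_at M p) p) v.
Proof.
by move=> cp; rewrite /tcoord deriveE //; apply: transition_diff => //; exact: mem_chart_at.
Qed.

Lemma tvectE c x u : chart_image c x ->
  tvect c x u = 'd (phi (chart_at M (psi c x)) \o psi c) x u.
Proof.
move=> cx; rewrite /tvect deriveE // -[X in differentiable _ X](psiK cx).
by apply: transition_diff; [exact: dom_psi|exact: mem_chart_at].
Qed.

Lemma diff_near_eq (F : normedModType R) (f g : E -> F) x :
  (\forall y \near x, f y = g y) -> differentiable f x -> differentiable g x ->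
  'd f x = 'd g x :> (E -> F).
Proof.
by move=> fg df dg; apply/funext => v; rewrite -!deriveE //; exact: near_eq_derive.
Qed.

(** The two changes of chart involved are mutually inverse near the point, so the
    chain rule makes their differentials inverse to each other. *)
Lemma tcoord_tvect c x u : chart_image c x -> tcoord c (psi c x) (tvect c x u) = u.
Proof.
move=> cx; have cp := dom_psi cx; rewrite tcoordE // tvectE //.
set p := psi c x in cp *; set d := chart_at M p.
have dp : dom d p by exact: mem_chart_at.
have dcd : differentiable (phi d \o psi c) x.
  by rewrite -(psiK cx); exact: transition_diff.
have ddc : differentiable (phi c \o psi d) ((phi d \o psi c) x).
  exact: transition_diff.
rewrite -[LHS]/(('d (phi c \o psi d) ((phi d \o psi c) x) \o 'd (phi d \o psi c) x) u).
rewrite -diff_comp // (@diff_near_eq _ _ id) ?diff_val //.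
- rewrite -(psiK cx); apply: filterS (near_dom_psi cp (dom_open HM d) dp).
  by move=> y [cy dy] /=; rewrite (phiK HM) // psiK.
- exact: differentiable_comp.
Qed.

(** The chain rule lets one fixed chart be used for the differential of f at all
    nearby points, although the tangent spaces are read in preferred charts that
    vary from point to point without any regularity. *)
Lemma differential_tcoord (f : M -> R) c p v : differentiable_function f ->
  dom c p ->
  differential f p v = 'd (f \o psi c : E -> R^o) (phi c p) (tcoord c p v).
Proof.
move=> df cp; set d := chart_at M p.
have dp : dom d p by exact: mem_chart_at.
have fd : differentiable (f \o psi d : E -> R^o) (phi d p).
  exact/df/chart_image_phi.
have fc : differentiable (f \o psi c : E -> R^o) ((phi c \o psi d) (phi d p)).
  by rewrite /= (phiK HM) //; exact/df/chart_image_phi.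
have tr := transition_diff dp cp.
rewrite tcoordE // -/d /differential -/d deriveE //.
have -> : 'd (f \o psi d : E -> R^o) (phi d p) =
    'd ((f \o psi c : E -> R^o) \o (phi c \o psi d)) (phi d p) :> (E -> R^o).
  apply: diff_near_eq => //; last exact: differentiable_comp.
  apply: filterS (near_dom_psi dp (dom_open HM c) cp) => y [dy cy] /=.
  by rewrite (phiK HM).
by rewrite (diff_comp tr fc) /= (phiK HM).
Qed.

Implicit Types (J : set R) (gam : R -> M).

Lemma curve_near J gam s (U : set M) : {within J, continuous gam} -> J s ->
  open U -> U (gam s) -> \forall t \near s, J t -> U (gam t).
Proof.
move=> /subspace_continuousP cg Js oU Us.
by apply: (cg s Js); apply: open_nbhs_nbhs; split.
Qed.

Lemma smooth_curve_deriv J gam s c : smooth_curve J gam -> J s -> dom c (gam s) ->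
  has_deriv_in J (phi c \o gam) s
    (derive_in (J `&` gam @^-1` dom c) (phi c \o gam) s).
Proof.
move=> [cg sg] Js cs; have := derivable_inP (sg c 0%N s (conj Js cs)).
apply: has_deriv_in_eq => //.
apply: filterS (curve_near cg Js (dom_open HM c) cs) => t h Jt.
by split => //; split => //; exact: h.
Qed.

Lemma velocity_tcoord J gam s c : smooth_curve J gam -> J s -> limit_point J s ->
  dom c (gam s) ->
  has_deriv_in J (phi c \o gam) s (tcoord c (gam s) (velocity J gam s)).
Proof.
move=> sg Js lJs cs; set d := chart_at M (gam s).
have ds : dom d (gam s) by exact: mem_chart_at.
have hd := smooth_curve_deriv sg Js ds.
rewrite /velocity (derive_inE lJs hd) tcoordE //.
have := has_deriv_in_comp (transition_diff ds cs) hd.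
apply: has_deriv_in_eq; last by rewrite /= (phiK HM).
apply: filterS (curve_near sg.1 Js (dom_open HM d) ds) => t h Jt.
by rewrite /= (phiK HM) //; exact: h.
Qed.

Lemma field_deriv J gam (V : R -> E) s c : {within J, continuous gam} ->
  smooth_field_along J gam V -> J s -> dom c (gam s) ->
  exists l, has_deriv_in J (fun t => tcoord c (gam t) (V t)) s l.
Proof.
move=> cg sV Js cs; have := derivable_inP (sV c 0%N s (conj Js cs)).
eexists; apply: has_deriv_in_eq H => //.
apply: filterS (curve_near cg Js (dom_open HM c) cs) => t h Jt.
by split => //; split => //; exact: h.
Qed.

End Charts.

(** * Christoffel symbols *)

Section ContinuityOfInverse.
Context (R : realType) (T : Type) (F : set_system T) (FF : Filter F).

Lemma cvg_sumr (I : Type) (r : seq I) (P : pred I) (f : I -> T -> R) (a : I -> R) :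
  (forall i, P i -> f i x @[x --> F] --> a i) ->
  \sum_(i <- r | P i) f i x @[x --> F] --> \sum_(i <- r | P i) a i.
Proof.
move=> fa; elim: r => [|i r IH].
  by under eq_cvg do rewrite big_nil; rewrite big_nil; exact: cvg_cst.
under eq_cvg do rewrite big_cons; rewrite big_cons.
by case: ifP => // Pi; apply: cvgD => //; exact: fa.
Qed.

Lemma cvg_prodr (I : Type) (r : seq I) (P : pred I) (f : I -> T -> R) (a : I -> R) :
  (forall i, P i -> f i x @[x --> F] --> a i) ->
  \prod_(i <- r | P i) f i x @[x --> F] --> \prod_(i <- r | P i) a i.
Proof.
move=> fa; elim: r => [|i r IH].
  by under eq_cvg do rewrite big_nil; rewrite big_nil; exact: cvg_cst.
under eq_cvg do rewrite big_cons; rewrite big_cons.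
by case: ifP => // Pi; apply: cvgM => //; exact: fa.
Qed.

Lemma cvg_det n (f : T -> 'M[R]_n) (A : 'M[R]_n) :
  (forall i j, f x i j @[x --> F] --> A i j) -> \det (f x) @[x --> F] --> \det A.
Proof.
move=> fA; rewrite /determinant; apply: cvg_sumr => s _.
by apply: cvgM; [exact: cvg_cst|apply: cvg_prodr].
Qed.

(** By Cramer's rule; invertibility near the limit is assumed because [invmx] is the
    identity on singular matrices. *)
Lemma cvg_invmx n (f : T -> 'M[R]_n) (A : 'M[R]_n) :
  (forall i j, f x i j @[x --> F] --> A i j) -> A \in unitmx ->
  (\forall x \near F, f x \in unitmx) ->
  forall i j, invmx (f x) i j @[x --> F] --> invmx A i j.
Proof.
move=> fA uA uf i j.
have -> : invmx A i j = (\det A)^-1 * cofactor A j i.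
  by rewrite /invmx uA !mxE.
apply: (@cvg_trans _ ((\det (f x))^-1 * cofactor (f x) j i @[x --> F])).
  apply: near_eq_cvg; apply: filterS uf => x ux.
  by rewrite /invmx ux !mxE.
apply: cvgM.
  by apply: cvgV; [move: uA; rewrite unitmxE unitfE|exact: cvg_det].
apply: cvgM; first exact: cvg_cst.
by apply: cvg_det => k l; rewrite !mxE; under eq_cvg do rewrite !mxE; exact: fA.
Qed.

End ContinuityOfInverse.

Section BilinearForm.
Context (R : realType) (n : nat).
Implicit Types (T : 'I_n -> 'I_n -> 'I_n -> R) (v w : 'rV[R]_n).

Definition bilin_row T v w : 'rV[R]_n :=
  \row_(k < n) \sum_(i < n) \sum_(j < n) T k i j * v 0 i * w 0 j.

Lemma bilin_rowDl T u v w :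
  bilin_row T (u + v) w = bilin_row T u w + bilin_row T v w.
Proof.
apply/rowP => k; rewrite !mxE -big_split; apply: eq_bigr => i _ /=.
rewrite -big_split; apply: eq_bigr => j _ /=; rewrite mxE; ring.
Qed.

Lemma bilin_rowDr T u v w :
  bilin_row T u (v + w) = bilin_row T u v + bilin_row T u w.
Proof.
apply/rowP => k; rewrite !mxE -big_split; apply: eq_bigr => i _ /=.
rewrite -big_split; apply: eq_bigr => j _ /=; rewrite mxE; ring.
Qed.

Lemma bilin_rowZr T c v w : bilin_row T v (c *: w) = c *: bilin_row T v w.
Proof.
apply/rowP => k; rewrite !mxE mulr_sumr; apply: eq_bigr => i _.
rewrite mulr_sumr; apply: eq_bigr => j _; rewrite mxE; ring.
Qed.

Lemma bilin_rowZl T c v w : bilin_row T (c *: v) w = c *: bilin_row T v w.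
Proof.
apply/rowP => k; rewrite !mxE mulr_sumr; apply: eq_bigr => i _.
rewrite mulr_sumr; apply: eq_bigr => j _; rewrite mxE; ring.
Qed.

Lemma bilin_rowBl T u v w :
  bilin_row T (u - v) w = bilin_row T u w - bilin_row T v w.
Proof. by rewrite -scaleN1r bilin_rowDl bilin_rowZl scaleN1r. Qed.

Lemma bilin_rowBr T u v w :
  bilin_row T u (v - w) = bilin_row T u v - bilin_row T u w.
Proof. by rewrite -scaleN1r bilin_rowDr bilin_rowZr scaleN1r. Qed.

Lemma bilin_rowC T v w : (forall k i j, T k i j = T k j i) ->
  bilin_row T v w = bilin_row T w v.
Proof.
move=> sT; apply/rowP => k; rewrite !mxE exchange_big; apply: eq_bigr => i _ /=.
by apply: eq_bigr => j _; rewrite sT mulrAC.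
Qed.

Lemma bilin_row_polar T v w : (forall k i j, T k i j = T k j i) ->
  bilin_row T (v + w) (v + w) =
  bilin_row T v v + (bilin_row T v w) *+ 2 + bilin_row T w w.
Proof.
move=> sT; rewrite bilin_rowDl !bilin_rowDr (bilin_rowC w v) //.
by rewrite mulr2n !addrA.
Qed.

Lemma bilin_rowB T T' v w :
  bilin_row T v w - bilin_row T' v w =
  bilin_row (fun k i j => T k i j - T' k i j) v w.
Proof.
apply/rowP => k; rewrite !mxE -sumrB; apply: eq_bigr => i _.
rewrite -sumrB; apply: eq_bigr => j _; ring.
Qed.

Lemma bilin_row_le T v w :
  `|bilin_row T v w| <= (\sum_k \sum_i \sum_j `|T k i j|) * `|v| * `|w|.
Proof.
have S0 k : 0 <= \sum_i \sum_j `|T k i j| by do 2 apply: sumr_ge0 => ? _.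
apply: mx_norm_le => [|a k].
  by rewrite !mulr_ge0 //; apply: sumr_ge0 => k _.
rewrite mxE [in leRHS](bigD1 k) //= -[leRHS]mulrA mulrDl ler_wpDr //.
  by rewrite !mulr_ge0 //; apply: sumr_ge0.
rewrite mulr_suml (le_trans (ler_norm_sum _ _ _)) //; apply: ler_sum => i _.
rewrite mulr_suml (le_trans (ler_norm_sum _ _ _)) //; apply: ler_sum => j _.
by rewrite !normrM -mulrA ler_wpM2l // ler_pM // mx_entry_le_norm.
Qed.

Lemma bilin_row_sqrB_le T v w :
  `|bilin_row T v v - bilin_row T w w| <=
  (\sum_k \sum_i \sum_j `|T k i j|) * `|v - w| * (`|v| + `|w|).
Proof.
have -> : bilin_row T v v - bilin_row T w w =
    bilin_row T (v - w) v + bilin_row T w (v - w).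
  by rewrite bilin_rowBl bilin_rowBr addrA subrK.
rewrite (le_trans (ler_normD _ _)) // mulrDr lerD //; first exact: bilin_row_le.
by rewrite mulrAC; exact: bilin_row_le.
Qed.

End BilinearForm.

Section Christoffel.
Context (R : realType) (n : nat) (M : charted_space 'rV[R]_n).
Context (g : metric_field M).
Hypothesis Hg : is_riemannian_manifold g.
Let HM := Hg.1.
Implicit Types (c : chart M).

Lemma metricD p u v w : g p (u + v) w = g p u w + g p v w.
Proof. by have := metric_linear Hg.2 p 1 u v w; rewrite scale1r mul1r. Qed.

Lemma metric0 p w : g p 0 w = 0.
Proof. by apply: (addIr (g p 0 w)); rewrite -metricD addr0 add0r. Qed.

Lemma metricZ p a u w : g p (a *: u) w = a * g p u w.
Proof. by have := metric_linear Hg.2 p a u 0 w; rewrite addr0 metric0 addr0. Qed.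

Lemma metric_sum p (I : Type) (r : seq I) (u : I -> 'rV[R]_n) w :
  g p (\sum_(i <- r) u i) w = \sum_(i <- r) g p (u i) w.
Proof.
by elim: r => [|i r IH]; rewrite ?big_nil ?metric0 // !big_cons metricD IH.
Qed.

Lemma tvect_sum c x (v : 'rV[R]_n) : chart_image c x ->
  tvect c x v = \sum_i v 0 i *: tvect c x (basis_vec R i).
Proof.
move=> cx; rewrite tvectE // [in LHS](row_sum_delta v) linear_sum.
by apply: eq_bigr => i _; rewrite linearZ tvectE.
Qed.

Lemma local_metric_suml c x (v w : 'rV[R]_n) : chart_image c x ->
  local_metric g c x v w = \sum_i v 0 i * local_metric g c x (basis_vec R i) w.
Proof.
move=> cx; rewrite /local_metric tvect_sum // metric_sum.
by apply: eq_bigr => i _; rewrite metricZ.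
Qed.

Lemma local_metricC c x (v w : 'rV[R]_n) :
  local_metric g c x v w = local_metric g c x w v.
Proof. exact: (Defs.metric_sym Hg.2 (psi c x) (tvect c x v) (tvect c x w)). Qed.

(** A kernel vector v of the Gram matrix would be a tangent vector of length zero;
    it is not the zero vector because [tvect] is injective. *)
Lemma gram_unit c x : chart_image c x -> gram g c x \in unitmx.
Proof.
move=> cx; rewrite unitmxE unitfE; apply/negP => /det0P[v v0 vG].
have vj j : local_metric g c x v (basis_vec R j) = 0.
  have /rowP/(_ j) := vG; rewrite !mxE => <-.
  by rewrite local_metric_suml //; apply: eq_bigr => i _; rewrite mxE.
have vv : local_metric g c x v v = 0.
  rewrite local_metric_suml // big1 // => i _.
  by rewrite local_metricC vj mulr0.
have /(metric_pos Hg.2 (psi c x)) : tvect c x v != 0.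
  apply: contra v0 => /eqP tv.
  rewrite -(tcoord_tvect HM v cx) tv tcoordE //; last exact: dom_psi.
  by rewrite linear0.
by rewrite -/(local_metric g c x v v) vv ltxx.
Qed.

Lemma gram_entry c i j : (fun y => gram g c y i j : R^o) =
  (fun y => local_metric g c y (basis_vec R i) (basis_vec R j)).
Proof. by apply/funext => y; rewrite mxE. Qed.

Lemma gram_cvg c x i j : chart_image c x ->
  gram g c y i j @[y --> x] --> gram g c x i j.
Proof.
move=> cx; have /= := metric_smooth Hg.2 (basis_vec R i) (basis_vec R j) [::] cx.
by move=> /differentiable_continuous; rewrite -gram_entry.
Qed.

Lemma dgram_cvg c x l i j : chart_image c x ->
  dgram g c y l i j @[y --> x] --> dgram g c x l i j.
Proof.
move=> cx.
have /= := metric_smooth Hg.2 (basis_vec R i) (basis_vec R j) [:: basis_vec R l] cx.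
by rewrite -gram_entry => /differentiable_continuous.
Qed.

Lemma christoffel_cvg c x k i j : chart_image c x ->
  christoffel g c y k i j @[y --> x] --> christoffel g c x k i j.
Proof.
move=> cx; rewrite /christoffel; apply: (@cvgMl_tmp _ _ (nbhs x)).
apply: cvg_sumr => l _; apply: cvgM.
  apply: cvg_invmx; [by move=> ? ?; exact: gram_cvg|exact: gram_unit|].
  have : nbhs x (chart_image c).
    by apply: open_nbhs_nbhs; split => //; exact: image_open HM c.
  by apply: filterS => y; exact: gram_unit.
by apply: cvgB; [apply: cvgD|]; exact: dgram_cvg.
Qed.

Lemma christoffelC c x k i j : christoffel g c x k i j = christoffel g c x k j i.
Proof.
rewrite /christoffel; congr (_ * _); apply: eq_bigr => l _.
have -> : dgram g c x l i j = dgram g c x l j i.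
  rewrite /dgram (gram_entry c i j) (gram_entry c j i).
  have e : (fun y => local_metric g c y (basis_vec R i) (basis_vec R j)) =
      (fun y => local_metric g c y (basis_vec R j) (basis_vec R i)).
    by apply/funext => y; exact: local_metricC.
  exact: (congr1 (fun h : _ -> R^o => 'D_(basis_vec R l) h x) e).
by congr (_ * _); rewrite [dgram g c x i j l + _]addrC.
Qed.

Definition christoffel_form c x : 'rV[R]_n -> 'rV[R]_n -> 'rV[R]_n :=
  bilin_row (christoffel g c x).

Lemma christoffel_form_near c x e : chart_image c x -> 0 < e ->
  \forall y \near x, forall v w,
    `|christoffel_form c y v w - christoffel_form c x v w| <= e * `|v| * `|w|.
Proof.
move=> cx e0.
have : \sum_k \sum_i \sum_j `|christoffel g c y k i j - christoffel g c x k i j|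
    @[y --> x] --> \sum_(k < n) \sum_(i < n) \sum_(j < n) (0 : R).
  have FF := nbhs_filter x.
  apply: cvg_sumr => k _; apply: cvg_sumr => i _; apply: cvg_sumr => j _.
  rewrite -(@normr0 _ R) -(subrr (christoffel g c x k i j)).
  by apply: cvg_norm; apply: cvgB; [exact: christoffel_cvg|exact: cvg_cst].
rewrite big1; last by move=> k _; rewrite big1 // => i _; rewrite big1.
move=> /cvgrPdist_le/(_ e e0); apply: filterS => y le v w.
rewrite bilin_rowB (le_trans (bilin_row_le _ _ _)) // -!mulrA.
apply: ler_wpM2r; first exact: mulr_ge0.
by move: le; rewrite sub0r normrN; exact: le_trans (ler_norm _).
Qed.

End Christoffel.

(** * Geodesics in a chart *)

(** Continuous induction on [0, 1]: the supremum of the times up to which Q holds can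
    neither miss Q nor lie before 1. *)
Lemma real_induction (R : realType) (Q : R -> Prop) : Q 0 ->
  (forall s, 0 <= s < 1 -> (forall t, 0 <= t <= s -> Q t) ->
    \forall t \near s, Q t) ->
  (forall s, 0 < s <= 1 -> (forall t, 0 <= t < s -> Q t) -> Q s) ->
  forall t, 0 <= t <= 1 -> Q t.
Proof.
move=> Q0 Qopen Qclosed.
pose A := [set s : R | 0 <= s <= 1 /\ forall t, 0 <= t <= s -> Q t].
have A0 : A 0.
  split; first by rewrite lexx ler01.
  by move=> t; rewrite -eq_le => /eqP <-.
have A1 : ubound A 1 by move=> s [/andP[]].
have hA : has_sup A by split; [exists 0|exists 1].
pose s := sup A.
have s0 : 0 <= s by exact: (sup_upper_bound hA).
have s1 : s <= 1 by apply: ge_sup => //; exists 0.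
have Qlt t : 0 <= t < s -> Q t.
  move=> /andP[t0 ts]; have [u [_ Au] tu] := sup_gt hA.1 ts.
  by apply: Au; rewrite t0 ltW.
have Qs : Q s.
  move: s0; rewrite le_eqVlt => /predU1P[<- //|s0].
  by apply: Qclosed => //; rewrite s0.
have Qle t : 0 <= t <= s -> Q t.
  move=> /andP[t0]; rewrite le_eqVlt => /predU1P[-> //|ts].
  by apply: Qlt; rewrite t0.
suff s1' : s = 1 by rewrite -s1'.
apply/eqP; rewrite eq_le s1 leNgt; apply/negP => s1'.
have /nbhs_ballP[e /= e0 eQ] : \forall t \near s, Q t.
  by apply: Qopen => //; rewrite s0.
have : A (Num.min 1 (s + e / 2)).
  have mse : Num.min 1 (s + e / 2) <= s + e / 2 by rewrite ge_min lexx orbT.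
  split.
    by rewrite ge_min lexx le_min ler01 /= addr_ge0 // ltW // divr_gt0.
  move=> t /andP[t0 tm]; have [ts|st] := leP t s; first by apply: Qle; rewrite t0.
  apply: eQ; rewrite -ball_normE /= ltr_norml; lra.
move=> /(sup_upper_bound hA); rewrite -/s ge_min leNgt s1' /=; lra.
Qed.

Section GeodesicInChart.
Context (R : realType) (n : nat) (M : charted_space 'rV[R]_n).
Context (g : metric_field M).
Hypothesis Hg : is_riemannian_manifold g.
Let HM := Hg.1.
Implicit Types (c : chart M) (gam : R -> M).

Lemma limit_pointT (s : R) : limit_point setT s.
Proof.
apply: limit_point_interval => //; split => //.
by exists 0, 1; split => //; exact: ltr01.
Qed.

(** The velocity of a curve read in a fixed chart; where the curve is in the domain
    of c this is the derivative of phi c \o gam. *)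
Definition chart_velocity c gam (t : R) : 'rV[R]_n :=
  tcoord c (gam t) (velocity setT gam t).

Lemma near_dom c gam t : is_geodesic g setT gam -> dom c (gam t) ->
  \forall u \near t, dom c (gam u).
Proof.
move=> [_ [cg _] _] ct; apply: filterS (curve_near cg I (dom_open HM c) ct) => u.
exact.
Qed.

Lemma geodesic_velocity c gam t : is_geodesic g setT gam -> dom c (gam t) ->
  is_derive t 1 (phi c \o gam) (chart_velocity c gam t).
Proof.
move=> [_ sg _] ct; apply: (@has_deriv_in_is_derive _ _ setT).
  exact: filterT.
by apply: velocity_tcoord => //; exact: limit_pointT.
Qed.

(** The second derivative in the chart exists because the curve is smooth there. The
    geodesic equation then determines it. *)
Lemma geodesic_acceleration c gam t : is_geodesic g setT gam -> dom c (gam t) ->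
  is_derive t 1 (chart_velocity c gam)
    (- christoffel_form g c (phi c (gam t)) (chart_velocity c gam t)
         (chart_velocity c gam t)).
Proof.
move=> geo ct; have [_ sg cov] := geo.
set O := setT `&` gam @^-1` dom c.
have nO u : dom c (gam u) -> nbhs u O.
  by move=> cu; apply: filterS (near_dom geo cu).
have lO u : dom c (gam u) -> limit_point O u.
  move=> cu U Uu; have [y [yu _ [Oy Uy]]] := limit_pointT (filterI (nO u cu) Uu).
  by exists y.
have wE u : dom c (gam u) -> derive_in O (phi c \o gam) u = chart_velocity c gam u.
  move=> cu; apply: derive_inE; first exact: lO.
  exact/is_derive_has_deriv_in/geodesic_velocity.
have hw : has_deriv_in setT (chart_velocity c gam) t
    (derive_in O (derive_in O (phi c \o gam)) t).
  have := derivable_inP (sg.2 c 1%N t (conj I ct)); apply: has_deriv_in_eq; last exact: wE.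
  by apply: filterS (near_dom geo ct) => u cu _; split => //; exact: wE.
have := cov t I c ct; rewrite tcoordE // linear0.
rewrite (derive_inE (@limit_pointT t) hw).
have hy : has_deriv_in setT (phi c \o gam) t (chart_velocity c gam t).
  exact/is_derive_has_deriv_in/geodesic_velocity.
rewrite (derive_inE (@limit_pointT t) hy).
rewrite -[X in _ + X]/(christoffel_form g c (phi c (gam t)) (chart_velocity c gam t)
  (chart_velocity c gam t)) => /esym/eqP; rewrite addr_eq0 => /eqP <-.
by apply: has_deriv_in_is_derive hw; exact: filterT.
Qed.

End GeodesicInChart.

(** * Short geodesics stay in the chart *)

Section GeodesicEstimate.
Context (R : realType) (n : nat) (M : charted_space 'rV[R]_n).
Context (g : metric_field M).
Hypothesis Hg : is_riemannian_manifold g.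
Let HM := Hg.1.
Implicit Types (c : chart M) (gam : R -> M).

(** The image is compact, hence closed as the manifold is Hausdorff. This keeps a
    curve from leaving the domain of the chart while its coordinates stay in the
    ball. *)
Lemma closed_psi_ball c (x0 : 'rV[R]_n) r : 0 < r ->
  (forall y, `|y - x0| <= r -> chart_image c y) ->
  closed (psi c @` [set y | `|y - x0| <= r]).
Proof.
move=> r0 rc; apply: compact_closed; first exact: manifold_hausdorff HM.
apply: continuous_compact.
  apply: continuous_in_subspaceT => y /set_mem yr.
  exact: (psi_continuous HM (rc _ yr)).
have -> : [set y | `|y - x0| <= r] = closed_ball x0 r.
  rewrite closed_ballE //; apply/seteqP; split => y /=;
    by rewrite /closed_ball_ /= distrC.
apply: bounded_closed_compact; last exact: closed_ball_closed.
exists (`|x0| + r); split; first exact: num_real.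
move=> m mr y; rewrite closed_ballE // /closed_ball_ /= => yr.
rewrite -(subrK x0 y) (le_trans (ler_normD _ _)) // -[`|y - x0|]normrN opprB.
lra.
Qed.

(** Bootstrap. As long as the geodesic stays in the ball with speed at most 2|v|, it
    moves by at most 2|v| and its velocity changes by at most 4C|v|^2 <= |v|/2, so
    both bounds hold strictly and persist a little longer. *)
Lemma geodesic_confined c (x0 : 'rV[R]_n) (r C : R) gam v :
  chart_velocity c gam 0 = v ->
  (forall y, `|y - x0| <= r -> chart_image c y) ->
  (forall y, `|y - x0| <= r -> forall u w,
     `|christoffel_form g c y u w| <= C * `|u| * `|w|) ->
  is_geodesic g setT gam -> dom c (gam 0) -> v != 0 ->
  `|phi c (gam 0) - x0| + 2 * `|v| < r -> 8 * C * `|v| <= 1 ->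
  forall t, 0 <= t <= 1 -> [/\ dom c (gam t),
     `|phi c (gam t) - x0| <= r & `|chart_velocity c gam t| <= 2 * `|v|].
Proof.
move=> w0 rc GC geo c0 v0 vr Cv.
have nv : 0 < `|v| by rewrite normr_gt0.
have r0 : 0 < r by have := normr_ge0 (phi c (gam 0) - x0); lra.
have [_ [geo_within _] _] := geo.
have geo_cont := (continuous_subspace_setT gam).2 geo_within.
have C0 : 0 <= C.
  have := GC x0 _ v v; rewrite subrr normr0 => /(_ (ltW r0)) h.
  have := le_trans (normr_ge0 _) h; rewrite -mulrA pmulr_lge0 //; exact: mulr_gt0.
have cy t : dom c (gam t) -> (phi c \o gam) u @[u --> t] --> phi c (gam t).
  move=> /(geodesic_velocity Hg geo) [dy _].
  exact/differentiable_continuous/derivable1_diffP.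
have cw t : dom c (gam t) ->
    chart_velocity c gam u @[u --> t] --> chart_velocity c gam t.
  move=> /(geodesic_acceleration Hg geo) [dw _].
  exact/differentiable_continuous/derivable1_diffP.
have improve t : 0 <= t <= 1 -> (forall u, 0 <= u <= t -> [/\ dom c (gam u),
     `|phi c (gam u) - x0| <= r & `|chart_velocity c gam u| <= 2 * `|v|]) ->
   `|phi c (gam t) - x0| < r /\ `|chart_velocity c gam t| < 2 * `|v|.
  move=> /andP[t0 t1] Qt; split.
    have h : `|(phi c \o gam) t - (phi c \o gam) 0| <= 2 * `|v| * t.
      apply: (@mean_value_le _ _ _ _ (chart_velocity c gam)) => //.
      - by move=> u /Qt[cu _ _]; exact: (geodesic_velocity Hg geo cu).
      - by move=> u /Qt[].
    have := ler_normD ((phi c \o gam) t - (phi c \o gam) 0) (phi c (gam 0) - x0).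
    rewrite subrKA /=; move: h => /=.
    have : `|v| * t <= `|v| by rewrite ler_piMr.
    lra.
  have : `|chart_velocity c gam t - chart_velocity c gam 0| <=
      C * (2 * `|v|) * (2 * `|v|) * t.
    apply: (@mean_value_le _ _ _ _ (fun u => - christoffel_form g c (phi c (gam u))
      (chart_velocity c gam u) (chart_velocity c gam u))) => //.
    - by rewrite !mulr_ge0.
    - by move=> u /Qt[cu _ _]; exact: (geodesic_acceleration Hg geo cu).
    - move=> u /Qt[_ yu wu]; rewrite normrN (le_trans (GC _ yu _ _)) //; exact: ler_pM3.
  rewrite w0; have := ler_normD (chart_velocity c gam t - v) v; rewrite subrK.
  have : 8 * C * `|v| * (`|v| * t) <= `|v| * t.
    by rewrite ler_piMl // mulr_ge0.
  have : `|v| * t <= `|v| by rewrite ler_piMr.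
  lra.
apply: real_induction.
- by split => //; [lra|rewrite w0; lra].
- move=> s /andP[s0 s1] Qs.
  have s01 : 0 <= s <= 1 by rewrite s0 ltW.
  have [ys ws] := improve s s01 Qs.
  have [cs _ _] : [/\ dom c (gam s),
     `|phi c (gam s) - x0| <= r & `|chart_velocity c gam s| <= 2 * `|v|].
    by apply: Qs; rewrite s0 lexx.
  have nd := near_dom Hg geo cs.
  have n1 : \forall t \near s, `|phi c (gam t) - x0| <= r.
    apply: (@cvgr_norm_le _ _ _ (nbhs s) _ (fun t => phi c (gam t) - x0)
      (phi c (gam s) - x0)) => //.
    by apply: cvgB; [exact: cy|exact: cvg_cst].
  have n2 := cvgr_norm_le _ (cw s cs) _ ws.
  by apply: filterS3 nd n1 (n2 (nbhs_filter s)) => t.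
- move=> s /andP[s0 s1] Qs.
  have Qnear : \forall t \near s^'-, [/\ dom c (gam t),
     `|phi c (gam t) - x0| <= r & `|chart_velocity c gam t| <= 2 * `|v|].
    near=> t; apply: Qs; apply/andP; split; last by near: t; exact: nbhs_left_lt.
    by apply: ltW; near: t; exact: nbhs_left_gt.
  have cgam : gam t @[t --> s^'-] --> gam s.
    apply: cvg_at_left_filter.
    exact: geo_cont.
  (* At the limit time nothing is known yet about dom c: this is where the ball must be
     closed in M. *)
  have [y /= yr ys] : (psi c @` [set y | `|y - x0| <= r]) (gam s).
    apply: (closed_cvg _ (closed_psi_ball r0 rc) _ _ cgam).
    apply: filterS Qnear => t [ct yt _]; exists (phi c (gam t)) => //.
    exact: phiK HM _ _ ct.
  have cs : dom c (gam s) by rewrite -ys; apply: dom_psi => //; exact: rc.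
  split => //.
    by rewrite -ys psiK //; exact: rc.
  have h : `|chart_velocity c gam t| @[t --> s^'-] --> `|chart_velocity c gam s|.
    by apply: cvg_norm; apply: cvg_at_left_filter; exact: cw.
  by apply: (cvgr_to_le h); apply: filterS Qnear => t [].
Unshelve. all: by end_near. Qed.

End GeodesicEstimate.

(** * Second-order expansion of geodesics *)

Section SecondOrderExpansion.
Context (R : realType) (m n : nat).

Lemma is_derive_half_square (a : 'M[R]_(m, n)) (t : R) :
  is_derive t 1 (fun u : R => (u ^+ 2 / 2) *: a) (t *: a).
Proof.
apply: (@has_deriv_in_is_derive _ _ setT); first exact: filterT.
move=> e e0.
have a1 : 0 < `|a| + 1 by rewrite ltr_wpDl.
near=> u => _.
have -> : (u ^+ 2 / 2) *: a - (t ^+ 2 / 2) *: a - (u - t) *: (t *: a) =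
    ((u - t) ^+ 2 / 2) *: a.
  by rewrite scalerA -(scalerBl _ _ a) -(scalerBl _ _ a); congr (_ *: _); field.
have ut : `|u - t| <= e / (`|a| + 1).
  rewrite distrC; near: u.
  apply: (@cvgr_dist_le _ _ _ (nbhs t) _ id) => //.
  by rewrite divr_gt0.
rewrite normrZ normrM [`|2^-1|]gtr0_norm ?invr_gt0 // normrX.
have : `|u - t| * (`|a| + 1) <= e by rewrite -ler_pdivlMr.
have := normr_ge0 a; have u0 := normr_ge0 (u - t) => a0.
move=> /(ler_wpM2l u0); have := mulr_ge0 u0 u0; have := mulr_ge0 (mulr_ge0 u0 u0) a0.
rewrite expr2; lra.
Unshelve. all: by end_near. Qed.

Lemma is_derive_line (a : 'M[R]_(m, n)) (t : R) :
  is_derive t 1 (fun u : R => u *: a) a.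
Proof.
apply: (@has_deriv_in_is_derive _ _ setT); first exact: filterT.
move=> e e0; apply: filterE => u _.
by rewrite -scalerBl subrr normr0 mulr_ge0 // ltW.
Qed.

(** Two applications of the mean value inequality, first to the velocity and then to
    the position. *)
Lemma second_order_expansion (y w a : R -> 'M[R]_(m, n)) A K :
  (forall t : R, 0 <= t <= 1 -> is_derive t 1 y (w t)) ->
  (forall t : R, 0 <= t <= 1 -> is_derive t 1 w (a t)) ->
  (forall t, 0 <= t <= 1 -> `|a t - A| <= K) ->
  `|y 1 - (y 0 + w 0 + 2^-1 *: A)| <= K.
Proof.
move=> dy dw aK.
have K0 : 0 <= K by apply: le_trans (aK 0 _); rewrite // lexx ler01.
have z_le t : 0 <= t <= 1 -> `|w t - w 0 - t *: A| <= K.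
  move=> /andP[t0 t1]; apply: (@le_trans _ _ (K * t)); last by rewrite ler_piMr.
  have sub u : 0 <= u <= t -> 0 <= u <= 1 by move=> /andP[-> /le_trans->].
  have := @mean_value_le _ _ _ (fun u => w u - w 0 - u *: A)
    (fun u => a u - A) t K t0 K0.
  rewrite subrr scale0r !subr0; apply => u /sub u01; last exact: aK.
  have := is_deriveB (is_deriveB (dw u u01) (is_derive_cst (w 0) u 1))
    (is_derive_line A u).
  by rewrite subr0.
have := @mean_value_le _ _ _ (fun u => y u - u *: w 0 - (u ^+ 2 / 2) *: A)
  (fun u => w u - w 0 - u *: A) 1 K ler01 K0.
rewrite scale1r !scale0r expr0n /= mul0r scale0r !subr0 expr1n mulr1 div1r.
have -> : y 1 - (y 0 + w 0 + 2^-1 *: A) = y 1 - w 0 - 2^-1 *: A - y 0.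
  by rewrite !opprD !addrA [y 1 - y 0 - _]addrAC [LHS]addrAC.
apply => // t t01.
exact: is_deriveB (is_deriveB (dy t t01) (is_derive_line _ _))
  (is_derive_half_square _ _).
Qed.

End SecondOrderExpansion.

Section ExpansionOfGeodesics.
Context (R : realType) (n : nat) (M : charted_space 'rV[R]_n).
Context (g : metric_field M).
Hypothesis Hg : is_riemannian_manifold g.
Let HM := Hg.1.
Implicit Types (c : chart M) (gam : R -> M).

(** The acceleration is - Gamma_y(w, w) with y near x0 and w = v + O(|v|^2), hence
    - Gamma_x0(v, v) + o(|v|^2) on the whole of [0, 1]. Half of the error allowed
    is spent on moving the base point of Gamma, half on replacing w by v. The
    constants come from |w| <= 2|v| and |w - v| <= 4 C1 |v|^2. *)
Lemma geodesic_estimate c (x0 : 'rV[R]_n) : chart_image c x0 ->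
  forall e, 0 < e -> exists2 d, 0 < d & forall gam x v,
    phi c (gam 0) = x -> chart_velocity c gam 0 = v ->
    is_geodesic g setT gam -> dom c (gam 0) -> v != 0 ->
    `|x - x0| <= d -> `|v| <= d ->
    dom c (gam 1) /\
    `|phi c (gam 1) - (x + v - 2^-1 *: christoffel_form g c x0 v v)|
      <= e * `|v| ^+ 2.
Proof.
move=> cx0 e e0; set G0 := christoffel_form g c x0.
have [C [C0 G0C G0B]] : exists C, [/\ 0 <= C,
    forall u w, `|G0 u w| <= C * `|u| * `|w| &
    forall u w, `|G0 u u - G0 w w| <= C * `|u - w| * (`|u| + `|w|)].
  exists (\sum_k \sum_i \sum_j `|christoffel g c x0 k i j|); split.
  - by apply: sumr_ge0 => k _; apply: sumr_ge0 => i _; apply: sumr_ge0.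
  - by move=> u w; exact: bilin_row_le.
  - by move=> u w; exact: bilin_row_sqrB_le.
have e80 : 0 < e / 8 by rewrite divr_gt0.
have [r r0 rP] : exists2 r, 0 < r & forall y, `|y - x0| <= r ->
    chart_image c y /\ forall u w,
      `|christoffel_form g c y u w - G0 u w| <= e / 8 * `|u| * `|w|.
  have : \forall y \near x0, chart_image c y /\ forall u w,
      `|christoffel_form g c y u w - G0 u w| <= e / 8 * `|u| * `|w|.
    apply: filterI; last exact: christoffel_form_near.
    by apply: open_nbhs_nbhs; split => //; exact: image_open HM c.
  move=> /nbhs_ballP[r /= r0 rP]; exists (r / 2); first by rewrite divr_gt0.
  move=> y yr; apply: rP; rewrite -ball_normE /= distrC; lra.
have [C1 C10 GC] : exists2 C1, 0 < C1 & forall y u w, `|y - x0| <= r ->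
    `|christoffel_form g c y u w| <= C1 * `|u| * `|w|.
  exists (C + e / 8) => [|y u w]; first by rewrite ltr_wpDl.
  move=> /rP[_ /(_ u w) h]; have := ler_normD (christoffel_form g c y u w - G0 u w) (G0 u w).
  rewrite subrK => h'; by rewrite (le_trans h') // !mulrDl addrC lerD.
have [d [d0 dr dC de]] : exists d, [/\ 0 < d, d <= r / 4, 8 * C1 * d <= 1 &
    12 * C * C1 * d <= e / 2].
  exists (Num.min (r / 4) (Num.min (8 * C1)^-1 (e / 2 / (12 * (C + 1) * C1)))).
  have C12 : 0 < 12 * (C + 1) * C1 by rewrite !mulr_gt0 // ltr_wpDl.
  have d0 : 0 < Num.min (r / 4) (Num.min (8 * C1)^-1 (e / 2 / (12 * (C + 1) * C1))).
    rewrite !lt_min; apply/and3P; split; first exact: divr_gt0.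
      by rewrite invr_gt0 mulr_gt0.
    by rewrite !divr_gt0.
  split=> //.
  - by rewrite ge_min lexx.
  - by rewrite mulrC -ler_pdivlMr ?mulr_gt0 // div1r !ge_min lexx !orbT.
  - apply: (@le_trans _ _ (12 * (C + 1) * C1 *
      Num.min (r / 4) (Num.min (8 * C1)^-1 (e / 2 / (12 * (C + 1) * C1))))).
      by rewrite ler_pM2r // ler_pM2r // ler_pM2l // lerDl.
    by rewrite mulrC -ler_pdivlMr // !ge_min lexx !orbT.
exists d => // gam x v y0 w0 geo c0 v0 xd vd.
have nv : 0 < `|v| by rewrite normr_gt0.
have Q : forall t, 0 <= t <= 1 -> [/\ dom c (gam t),
     `|phi c (gam t) - x0| <= r & `|chart_velocity c gam t| <= 2 * `|v|].
  have vr : `|phi c (gam 0) - x0| + 2 * `|v| < r by rewrite y0; lra.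
  have Cv : 8 * C1 * `|v| <= 1.
    by rewrite (le_trans _ dC) // ler_pM2l ?mulr_gt0.
  have rc y : `|y - x0| <= r -> chart_image c y by move=> /rP[].
  have GC' y : `|y - x0| <= r -> forall u w,
      `|christoffel_form g c y u w| <= C1 * `|u| * `|w|.
    by move=> yr u w; exact: GC.
  exact: (geodesic_confined Hg w0 rc GC' geo c0 v0 vr Cv).
have [c1 _ _] := Q 1 (introT andP (conj ler01 (lexx 1))).
split=> //.
have dy (t : R) : 0 <= t <= 1 -> is_derive t 1 (phi c \o gam) (chart_velocity c gam t).
  by move=> /Q[ct _ _]; exact: (geodesic_velocity Hg geo ct).
have dw (t : R) : 0 <= t <= 1 -> is_derive t 1 (chart_velocity c gam)
   (- christoffel_form g c (phi c (gam t)) (chart_velocity c gam t)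
         (chart_velocity c gam t)).
  by move=> /Q[ct _ _]; exact: (geodesic_acceleration Hg geo ct).
have w_le t : 0 <= t <= 1 -> `|chart_velocity c gam t - v| <= 4 * C1 * `|v| ^+ 2.
  move=> /andP[t0 t1]; apply: (@le_trans _ _ (4 * C1 * `|v| ^+ 2 * t)); last first.
    by rewrite ler_piMr // !mulr_ge0 // ltW.
  have sub u : 0 <= u <= t -> 0 <= u <= 1 by move=> /andP[-> /le_trans->].
  rewrite -{1}w0; apply: (@mean_value_le _ _ _ _ (fun u => - christoffel_form g c
    (phi c (gam u)) (chart_velocity c gam u) (chart_velocity c gam u))) =>
    // [|u /sub/dw //|u /sub/Q[_ yu wu]].
    by rewrite !mulr_ge0 // ltW.
  rewrite normrN (le_trans (GC _ _ _ yu)) //.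
  have -> : 4 * C1 * `|v| ^+ 2 = C1 * (2 * `|v|) * (2 * `|v|) by ring.
  by rewrite ler_pM3 // ltW.
rewrite -scalerN; have := @second_order_expansion _ _ _ _ _ _ (- G0 v v) (e * `|v| ^+ 2) dy dw.
rewrite /= y0 w0; apply => t t01.
have [_ yt wt] := Q t t01; have wvt := w_le t t01.
move: (chart_velocity c gam t) wt wvt => w wt wvt.
have [_ /(_ w w) h1] := rP _ yt.
rewrite opprK addrC -normrN opprB -(subrKA (G0 w w)) (le_trans (ler_normD _ _)) //.
have h3 : e / 8 * `|w| * `|w| <= e / 2 * `|v| ^+ 2.
  have -> : e / 2 * `|v| ^+ 2 = e / 8 * (2 * `|v|) * (2 * `|v|) by field.
  by rewrite ler_pM3 // ltW.
have h4 : `|G0 w w - G0 v v| <= e / 2 * `|v| ^+ 2.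
  rewrite (le_trans (G0B w v)) //.
  apply: (@le_trans _ _ (12 * C * C1 * d * `|v| ^+ 2)); last first.
    by rewrite ler_wpM2r // sqr_ge0.
  have -> : 12 * C * C1 * d * `|v| ^+ 2 = C * (4 * C1 * `|v| ^+ 2 * (3 * d)).
    by ring.
  rewrite -mulrA ler_wpM2l // ler_pM //; lra.
lra.
Qed.

End ExpansionOfGeodesics.

(** * The gradient of an affine function is parallel *)

Section MovingCovector.
Context (R : realType) (E : normedModType R).

(** A product rule for the pairing of a covector D x, moving with its base point, with
    a vector. D is differentiable at y s in the sense of the estimate on
    D (y s + h) v, its derivative in the direction h being v |-> D (y s) (G h v). *)
Lemma moving_covector_deriv (D : E -> {linear E -> R^o}) (G : E -> E -> E)
    (C : R) (J : set R) (y w : R -> E) (s : R) (y' w' : E) :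
  continuous (D (y s)) -> 0 <= C ->
  (forall u v, `|G u v| <= C * `|u| * `|v|) ->
  (forall u v z, G (u - v) z = G u z - G v z) ->
  (forall u v z, G z (u - v) = G z u - G z v) ->
  (forall a u v, G (a *: u) v = a *: G u v) ->
  (forall e, 0 < e -> exists2 d, 0 < d & forall h v, `|h| <= d ->
    `|(D (y s + h) v : R) - D (y s) v - D (y s) (G h v)| <= e * `|h| * `|v|) ->
  has_deriv_in J y s y' -> has_deriv_in J w s w' ->
  has_deriv_in J (fun t => D (y t) (w t) : R^o) s
    (D (y s) (w' + G y' (w s))).
Proof.
move=> Dc C0 GC GBl GBr GZ hess hy hw.
have [k k0 kD] := linear_lipschitz Dc.
move=> e e0.
have m0 : 0 <= `|w s| + 1 by rewrite addr_ge0.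
have p0 : 0 <= `|y'| + 1 by rewrite addr_ge0.
have [e1 [e10 e11 e1K]] : exists e1, [/\ 0 < e1, e1 <= 1 &
    e1 * ((`|y'| + 1) * (`|w s| + 1) + k + k * C * (`|w s| + 1) + k * C * `|y'|)
      <= e].
  pose K := (`|y'| + 1) * (`|w s| + 1) + k + k * C * (`|w s| + 1) + k * C * `|y'|.
  have K0 : 0 < K.
    rewrite /K -!addrA ltr_wpDl ?mulr_ge0 // ltr_pwDl // addr_ge0 //.
      by rewrite !mulr_ge0 // ltW.
    by rewrite !mulr_ge0 // ltW.
  exists (Num.min 1 (e / K)); split.
  - by rewrite lt_min ltr01 divr_gt0.
  - by rewrite ge_min lexx.
  - by rewrite -ler_pdivlMr // ge_min lexx orbT.
have [d d0 {}hess] := hess e1 e10.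
have n1 := hy e1 e10; have n2 := has_deriv_in_lip hy; have n3 := hw e1 e10.
have n4 : \forall t \near s, J t -> `|w t - w s| <= e1.
  apply: (has_deriv_in_near hw (P := fun z => `|z - w s| <= e1)).
  apply/nbhs_ballP; exists e1 => // z; rewrite -ball_normE /= distrC; exact: ltW.
have n5 : \forall t \near s, J t -> `|y t - y s| <= d.
  apply: (has_deriv_in_near hy (P := fun z => `|z - y s| <= d)).
  apply/nbhs_ballP; exists d => // z; rewrite -ball_normE /= distrC; exact: ltW.
near=> t => Jt.
have h1 : `|y t - y s - (t - s) *: y'| <= e1 * `|t - s|.
  by move: Jt; near: t.
have h2 : `|y t - y s| <= (`|y'| + 1) * `|t - s| by move: Jt; near: t.
have h3 : `|w t - w s - (t - s) *: w'| <= e1 * `|t - s| by move: Jt; near: t.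
have h4 : `|w t - w s| <= e1 by move: Jt; near: t.
have h5 : `|y t - y s| <= d by move: Jt; near: t.
have wt : `|w t| <= `|w s| + 1.
  have := ler_normD (w t - w s) (w s); rewrite subrK; lra.
have := hess (y t - y s) (w t) h5; rewrite [y s + _]addrC subrK => h6.
pose D0 u : R := D (y s) u.
have D0D u v : D0 (u + v) = D0 u + D0 v by rewrite /D0 linearD.
have D0Z a u : D0 (a *: u) = a * D0 u by rewrite /D0 linearZ.
have D0B u v : D0 (u - v) = D0 u - D0 v by rewrite /D0 linearB.
have split_D : (D (y t) (w t) : R) - D0 (w s) - (t - s) * D0 (w' + G y' (w s)) =
   ((D (y t) (w t) : R) - D0 (w t) - D0 (G (y t - y s) (w t)))
   + D0 (w t - w s - (t - s) *: w')
   + (D0 (G (y t - y s - (t - s) *: y') (w t)) + (t - s) * D0 (G y' (w t - w s))).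
  by rewrite GBr !GBl GZ !D0B D0D !D0Z; ring.
rewrite [X in `|X|]split_D.
have q1 : e1 * `|y t - y s| * `|w t| <= e1 * ((`|y'| + 1) * `|t - s|) * (`|w s| + 1).
  by rewrite ler_pM3 // ltW.
have q2 : `|D0 (w t - w s - (t - s) *: w')| <= k * (e1 * `|t - s|).
  by rewrite (le_trans (kD _)) // (ler_wpM2l (ltW k0)).
have q3 : `|D0 (G (y t - y s - (t - s) *: y') (w t))| <=
    k * (C * (e1 * `|t - s|) * (`|w s| + 1)).
  rewrite (le_trans (kD _)) // (ler_wpM2l (ltW k0)) // (le_trans (GC _ _)) //.
  by rewrite ler_pM3.
have q4 : `|(t - s) * D0 (G y' (w t - w s))| <= `|t - s| * (k * (C * `|y'| * e1)).
  rewrite normrM ler_wpM2l // (le_trans (kD _)) // (ler_wpM2l (ltW k0)) //.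
  by rewrite (le_trans (GC _ _)) // ler_pM3.
have q5 : e1 * ((`|y'| + 1) * (`|w s| + 1) + k + k * C * (`|w s| + 1) + k * C * `|y'|)
    * `|t - s| <= e * `|t - s| by rewrite ler_wpM2r.
rewrite (le_trans (ler_normD _ _)) // (le_trans (lerD (ler_normD _ _) (ler_normD _ _))) //.
move: (le_trans h6 q1) q2 q3 q4 q5; lra.
Unshelve. all: by end_near. Qed.

End MovingCovector.

Section Affine.
Context (R : realType) (n : nat) (M : charted_space 'rV[R]_n).
Context (g : metric_field M) (f : M -> R).
Hypothesis Hg : is_riemannian_manifold g.
Hypothesis Hcomplete : is_complete g.
Hypothesis Hdiff : differentiable_function f.
Hypothesis Haffine : is_affine g f.
Let HM := Hg.1.
Implicit Types (c : chart M) (gam : R -> M).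

(** Completeness provides a geodesic with the prescribed initial velocity up to
    time 1. The slope of f along it is the derivative of f in that direction. *)
Lemma affine_on_geodesic c (x v : 'rV[R]_n) : chart_image c x ->
  exists gam, [/\ is_geodesic g setT gam, dom c (gam 0), phi c (gam 0) = x,
    chart_velocity c gam 0 = v &
    f (gam 1) = f (psi c x) + ('d (f \o psi c : _ -> R^o) x v : R)].
Proof.
move=> cx; have [gam [geo g0 gv]] := Hcomplete (psi c x) (tvect c x v).
have c0 : dom c (gam 0) by rewrite g0; exact: dom_psi.
have x0 : phi c (gam 0) = x by rewrite g0; exact: psiK.
have w0 : chart_velocity c gam 0 = v.
  by rewrite /chart_velocity gv g0; exact: tcoord_tvect.
exists gam; split => //.
have [a [b fab]] := Haffine geo.
have d1 : has_deriv_in setT (f \o gam : R -> R^o) 0 ('d (f \o psi c : _ -> R^o) x v).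
  have df : differentiable (f \o psi c : _ -> R^o) ((phi c \o gam) 0).
    by rewrite /= x0; exact: Hdiff.
  have h0 : has_deriv_in setT (phi c \o gam) 0 (chart_velocity c gam 0).
    exact: is_derive_has_deriv_in (geodesic_velocity Hg geo c0).
  have := has_deriv_in_comp df h0.
  rewrite /= x0 w0; apply: has_deriv_in_eq; last by rewrite /= (phiK HM).
  by apply: filterS (near_dom Hg geo c0) => u cu _; rewrite /= (phiK HM).
have d2 : has_deriv_in setT (f \o gam : R -> R^o) 0 (a : R^o).
  move=> e e0; apply: filterE => t _.
  have -> : (f \o gam) t - (f \o gam) 0 - (t - 0) *: (a : R^o) = 0 :> R^o.
    by rewrite /= !fab //; rewrite /GRing.scale /=; ring.
  by rewrite normr0 mulr_ge0 // ltW.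
have l0 : limit_point [set: R] 0 by exact: limit_pointT.
have -> : 'd (f \o psi c : _ -> R^o) x v = a.
  by rewrite -(derive_inE l0 d1) (derive_inE l0 d2).
by rewrite -g0 !fab // mulr0 add0r mulr1 addrC.
Qed.

(** In the chart the second derivative of f is df composed with the Christoffel form,
    that is, the covariant Hessian of f vanishes. *)
Lemma affine_hessian c (x0 : 'rV[R]_n) : chart_image c x0 ->
  forall e, 0 < e -> exists2 d, 0 < d & forall h w, `|h| <= d ->
    `|('d (f \o psi c : _ -> R^o) (x0 + h) w : R) - 'd (f \o psi c : _ -> R^o) x0 w
      - 'd (f \o psi c : _ -> R^o) x0 (christoffel_form g c x0 h w)|
    <= e * `|h| * `|w|.
Proof.
move=> cx0; set G0 := christoffel_form g c x0.
have nc : \forall x \near x0, chart_image c x.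
  by apply: open_nbhs_nbhs; split => //; exact: image_open HM c.
apply: (@hessian_of_geodesics _ _ _ _ G0
  (\sum_k \sum_i \sum_j `|christoffel g c x0 k i j|)).
- by apply: sumr_ge0 => k _; apply: sumr_ge0 => i _; apply: sumr_ge0.
- by move=> v w; exact: bilin_row_le.
- by move=> v w; apply: bilin_row_polar => k i j; exact: christoffelC.
- by move=> a v w; exact: bilin_rowZr.
- by apply: filterS nc => x cx; exact: Hdiff.
move=> e e0; have [d1 d10 est] := geodesic_estimate Hg cx0 e0.
have /nbhs_ballP[d2 /= d20 d2c] := nc.
exists (Num.min d1 (d2 / 2)); first by rewrite lt_min d10 divr_gt0.
move=> x v; rewrite !le_min => /andP[xd1 xd2] /andP[vd1 _].
have cx : chart_image c x by apply: d2c; rewrite -ball_normE /= distrC; lra.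
have [->|v0] := eqVneq v 0.
  exists x; rewrite linear0 !addr0 normr0 expr0n mulr0; split => //.
  rewrite -{1}(scale0r (0 : 'rV[R]_n)) /G0 /christoffel_form bilin_rowZl.
  by rewrite !scale0r scaler0 subr0 subrr normr0.
have [gam [geo c0 y0 w0 f1]] := affine_on_geodesic v cx.
have [c1 y1] := est gam x v y0 w0 geo c0 v0 xd1 vd1.
by exists (phi c (gam 1)); split => //=; rewrite (phiK HM).
Qed.

(** In terms of the gradient X of f this is <V, X>' = <DV/ds, X>: the Christoffel
    term produced by the Hessian is the one in the covariant derivative of V. *)
Lemma affine_deriv_along (J : set R) (al : R -> M) (V : R -> 'rV[R]_n) s W :
  smooth_curve J al -> smooth_field_along J al V -> J s -> limit_point J s ->
  is_cov_derive g J al V s W ->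
  has_deriv_in J (fun t => differential f (al t) (V t) : R^o) s
    (differential f (al s) W).
Proof.
move=> sal sV Js lJs cov.
set c := chart_at M (al s).
have cs : dom c (al s) by exact: mem_chart_at.
have nc := curve_near sal.1 Js (dom_open HM c) cs.
pose F := (f \o psi c : _ -> R^o).
have hy := smooth_curve_deriv HM sal Js cs.
have [w' hw] := field_deriv HM sal.1 sV Js cs.
have := cov c cs; rewrite (derive_inE lJs hw) (derive_inE lJs hy).
move: hy; set y := phi c \o al; set y' := derive_in _ _ _ => hy.
set w := (fun t => tcoord c (al t) (V t)) in hw *.
rewrite -[X in _ + X]/(christoffel_form g c (y s) y' (w s)).
set G0 := christoffel_form g c (y s) => WE.
have fE t : dom c (al t) -> differential f (al t) (V t) = 'd F (y t) (w t).
  by move=> ct; exact: differential_tcoord.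
have -> : differential f (al s) W = 'd F (y s) w' + 'd F (y s) (G0 y' (w s)).
  by rewrite -linearD -WE; exact: differential_tcoord.
suff : has_deriv_in J (fun t => 'd F (y t) (w t) : R^o) s
    ('d F (y s) w' + 'd F (y s) (G0 y' (w s))).
  apply: has_deriv_in_eq; last by rewrite fE.
  by apply: filterS nc => t ct Jt; split => //; rewrite fE //; exact: ct.
have cys : chart_image c (y s) by exact: chart_image_phi.
have dF : differentiable F (y s) by exact: Hdiff.
have -> : 'd F (y s) w' + 'd F (y s) (G0 y' (w s)) = 'd F (y s) (w' + G0 y' (w s)).
  by rewrite linearD.
apply: (@moving_covector_deriv _ _ (fun x => 'd F x) G0
  (\sum_k \sum_i \sum_j `|christoffel g c (y s) k i j|)) => //.
- exact: diff_continuous.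
- by apply: sumr_ge0 => i _; apply: sumr_ge0 => j _; apply: sumr_ge0.
- by move=> u v; exact: bilin_row_le.
- by move=> u v z; exact: bilin_rowBl.
- by move=> u v z; exact: bilin_rowBr.
- by move=> a u v; exact: bilin_rowZl.
- exact: affine_hessian.
Qed.

End Affine.

(** * Recursion along the Frenet frame *)

Section FrenetRecursion.
Context (R : realType) (n : nat) (M : charted_space 'rV[R]_n).
Context (g : metric_field M) (f : M -> R) (gradf : M -> 'rV[R]_n).
Hypothesis Hg : is_riemannian_manifold g.
Hypothesis Hcomplete : is_complete g.
Hypothesis Hdiff : differentiable_function f.
Hypothesis Haffine : is_affine g f.
Hypothesis Hgrad : is_gradient g f gradf.
Context (I : set R) (alpha : R -> M) (V : nat -> R -> 'rV[R]_n) (k : nat -> R -> R).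
Hypothesis Hfrenet : is_frenet_curve g I alpha V k.

Let u j s := g (alpha s) (V j s) (gradf (alpha s)).

Lemma gradient_component_deriv j s : (1 <= j <= n)%N -> I s ->
  has_deriv_in I (u j : R -> R^o) s
    (- k j.-1 s * u j.-1 s + k j s * u j.+1 s).
Proof.
move=> jn Is; have uE t W : differential f (alpha t) W = g (alpha t) W (gradf (alpha t)).
  by rewrite Hgrad; exact: (Defs.metric_sym Hg.2).
have lI : limit_point I s.
  exact: limit_point_interval (frenet_interval Hfrenet) Is.
have := affine_deriv_along Hg Hcomplete Hdiff Haffine (frenet_smooth Hfrenet)
  (frenet_fields Hfrenet jn) Is lI (frenet_eq Hfrenet jn Is).
rewrite uE metricD // !metricZ //.
by apply: has_deriv_in_eq => //; apply: filterE => t It; split => //; exact: uE.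
Qed.

(** Two consecutive components determine the next one, so the induction carries two
    consecutive identities. For i = 0 the identity says that the component along
    V_(n-1) vanishes. *)
Lemma harmonic_recursion b : (3 <= n)%N -> b != 0 -> (forall s, I s -> u n s = b) ->
  forall i s, (i <= n - 2)%N -> I s ->
    u (n - i.+1)%N s = harmonic_curvature n I k i s * b.
Proof.
move=> n3 b0 ub.
have lI s : I s -> limit_point I s.
  exact: limit_point_interval (frenet_interval Hfrenet).
have kpos j s : (1 <= j <= n.-1)%N -> I s -> k j s != 0.
  by move=> jn Is; rewrite gt_eqF // (frenet_curvature_pos Hfrenet).
have cst_deriv (h : R -> R) (a : R) s : I s -> (forall t, I t -> h t = a) ->
    has_deriv_in I (h : R -> R^o) s (0 : R^o).
  move=> Is ha e e0; apply: filterE => t It.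
  by rewrite !ha // subrr scaler0 subrr normr0 mulr_ge0 // ltW.
have step0 s : I s -> u (n - 1)%N s = 0.
  move=> Is; have nn : (1 <= n <= n)%N by lia.
  have := derive_inE (lI s Is) (gradient_component_deriv nn Is).
  rewrite (derive_inE (lI s Is) (cst_deriv _ _ _ Is ub)).
  have -> : u n.+1 s = 0.
    by rewrite /u (frenet_ends Hfrenet Is).2 (metric0 Hg).
  rewrite mulr0 addr0 mulNr subn1 => /esym/eqP; rewrite oppr_eq0 mulf_eq0.
  by rewrite (negbTE (kpos n.-1 s _ Is)) //=; [move=> /eqP|lia].
have step1 s : I s -> u (n - 2)%N s = k n.-1 s / k (n - 2)%N s * b.
  move=> Is; have nn : (1 <= n - 1 <= n)%N by lia.
  have := derive_inE (lI s Is) (gradient_component_deriv nn Is).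
  rewrite (derive_inE (lI s Is) (cst_deriv _ _ _ Is step0)).
  have -> : (n - 1).-1 = (n - 2)%N by lia.
  have -> : (n - 1).+1 = n by lia.
  rewrite ub // subn1.
  have k0 : k (n - 2)%N s != 0 by apply: kpos => //; lia.
  move=> h; apply: (mulfI k0); rewrite mulrA mulrCA divff // mulr1.
  by move: h; lra.
pose P i := forall s, (i <= n - 2)%N -> I s ->
    u (n - i.+1)%N s = harmonic_curvature n I k i s * b.
suff PP i : P i /\ P i.+1 by move=> i s; exact: (PP i).1.
elim: i => [|i [Pi Pi1]].
  split => s _ Is; first by rewrite /= mul0r step0.
  exact: step1.
split=> // s i2 Is.
set j := (n - i.+2)%N.
have jn : (1 <= j <= n)%N by lia.
have j1 : j.-1 = (n - i.+3)%N by lia.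
have j2 : j.+1 = (n - i.+1)%N by lia.
have hu := gradient_component_deriv jn Is.
have hH : has_deriv_in I (harmonic_curvature n I k i.+1 : R -> R^o) s
    (b^-1 *: (- k j.-1 s * u j.-1 s + k j s * u j.+1 s : R^o)).
  have HE t : I t -> b^-1 *: (u j t : R^o) = harmonic_curvature n I k i.+1 t.
    by move=> It; rewrite /j (Pi1 t) //; [rewrite /GRing.scale /= mulrC mulfK|lia].
  apply: has_deriv_in_eq (has_deriv_inZ b^-1 hu); last exact: HE.
  by apply: filterE => t It; split => //; exact: HE.
have -> : harmonic_curvature n I k i.+2 s =
    (k (n - i.+3)%N s)^-1 * (k (n - i.+2)%N s * harmonic_curvature n I k i s -
     @derive_in R R^o I (harmonic_curvature n I k i.+1) s) by [].
rewrite (derive_inE (lI s Is) hH) -/j j1 j2 (Pi s) //; last by lia.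
have k0 : k (n - i.+3)%N s != 0 by apply: kpos => //; lia.
by rewrite /GRing.scale /=; field; rewrite k0 b0.
Qed.

End FrenetRecursion.

Unset Implicit Arguments.
Set Strict Implicit.

Theorem theorem4p1 (R : realType) (n : nat) (hn : (3 <= n)%N)
  (M : charted_space 'rV[R]_n) (g : metric_field M)
  (hM : is_riemannian_manifold g)
  (hconnected : connected [set: M])
  (hcomplete : is_complete g)
  (hproduct : exists (m : nat) (N : charted_space 'rV[R]_m)
      (gN : metric_field N),
    is_riemannian_manifold gN /\ isometric g (prod_line_metric gN))
  (f : M -> R) (gradf : M -> 'rV[R]_n)
  (hdiff : differentiable_function f)
  (haffine : is_affine g f)
  (hnontrivial : nontrivial_function f)
  (hgrad : is_gradient g f gradf)
  (I : set R) (alpha : R -> M)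
  (V : nat -> R -> 'rV[R]_n) (k : nat -> R -> R)
  (hfrenet : is_frenet_curve g I alpha V k)
  (hslant : is_eikonal_slant g I alpha V gradf) :
  forall (i : nat) (s : R), (1 <= i <= n - 2)%N -> I s ->
    g (alpha s) (V (n - i.+1)%N s) (gradf (alpha s)) =
    harmonic_curvature n I k i s * g (alpha s) (V n s) (gradf (alpha s)).
Proof.
move=> i s /andP[_ i2] Is; have [_ [b b0 Vb]] := hslant.
have Vn t : I t -> g (alpha t) (V n t) (gradf (alpha t)) = b.
  by move=> It; rewrite (Defs.metric_sym hM.2) Vb.
rewrite (Vn s Is).
exact: (harmonic_recursion hM hcomplete hdiff haffine hgrad hfrenet hn b0 Vn i2 Is).
Qed.
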